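(* There is a class function $f:\mathrm{Ord}\to\mathrm{Ord}$ such that for every uplifting cardinal $\kappa$, the restriction $f\restriction\kappa$ maps $\kappa$ into $\kappa$, is a definable class in $V_\kappa$, and has the uplifting Menas property for $\kappa$. In particular, every uplifting cardinal has a function with the uplifting Menas property.
   Context: An inaccessible cardinal $\kappa$ is uplifting if for every ordinal $\theta$ there is an inaccessible $\gamma\ge\theta$ with $V_\kappa\prec V_\gamma$ a proper elementary extension. For an uplifting $\kappa$, a (partial) function $f:\kappa\to\kappa$ has the uplifting Menas property for $\kappa$ if for every ordinal $\theta$ there are an inaccessible cardinal $\gamma>\theta$ and a function $f^*:\gamma\to\gamma$ such that $\langle V_\kappa,\in,f\rangle\prec\langle V_\gamma,\in,f^*\rangle$ and $\theta\le f^*(\kappa)$. *)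

(* Defs.v *)
(** The theorem is a theorem (scheme) of ZFC.  It is rendered semantically: it
    is asserted in every model [M] of first-order ZFC, where "class" means
    "definable by a first-order formula".  All set-theoretic notions below are
    the usual first-order ones, evaluated inside [M].  In particular
    satisfaction and elementarity between sets of [M] refer to [M]'s own coded
    formulas, since the natural numbers of [M] may be nonstandard. *)

Record structure := Structure {
  carrier :> Type;
  mem : carrier -> carrier -> Prop
}.
Arguments mem {_} _ _.
Notation "x ∈ y" := (mem x y) (at level 70, no associativity).

(** ** Formulas of the language of set theory (de Bruijn indices) *)

Inductive formula : Type :=
| Fmem (i j : nat)
| Feq (i j : nat)
| Fneg (p : formula)
| Fand (p q : formula)
| Fex (p : formula).

Definition scons {T : Type} (x : T) (e : nat -> T) : nat -> T :=
  fun n => match n with 0 => x | S m => e m end.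

Fixpoint holds {M : structure} (p : formula) (e : nat -> M) : Prop :=
  match p with
  | Fmem i j => e i ∈ e j
  | Feq i j => e i = e j
  | Fneg p => ~ holds p e
  | Fand p q => holds p e /\ holds q e
  | Fex p => exists x : M, holds p (scons x e)
  end.

(** [p] defines the binary class [F] without parameters: the truth value of [p]
    depends only on the values of the variables 0 and 1. *)
Definition defines {M : structure} (p : formula) (F : M -> M -> Prop) : Prop :=
  forall e : nat -> M, holds p e <-> F (e 0) (e 1).

(** ** ZFC *)

Definition subset {M : structure} (x y : M) : Prop :=
  forall z : M, z ∈ x -> z ∈ y.

Definition is_empty {M : structure} (x : M) : Prop := forall z : M, ~ z ∈ x.

Definition is_pair {M : structure} (p x y : M) : Prop :=
  forall z : M, z ∈ p <-> z = x \/ z = y.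

Definition is_power {M : structure} (p x : M) : Prop :=
  forall z : M, z ∈ p <-> subset z x.

Definition is_succ {M : structure} (y x : M) : Prop :=
  forall z : M, z ∈ y <-> z ∈ x \/ z = x.

Definition inductive_set {M : structure} (w : M) : Prop :=
  (exists o : M, is_empty o /\ o ∈ w) /\
  (forall x : M, x ∈ w -> exists y : M, is_succ y x /\ y ∈ w).

Record ZFC (M : structure) : Prop := {
  zf_extensionality :
    forall x y : M, (forall z : M, z ∈ x <-> z ∈ y) -> x = y;
  zf_foundation :
    forall x : M, (exists y : M, y ∈ x) ->
      exists y : M, y ∈ x /\ forall z : M, z ∈ y -> ~ z ∈ x;
  zf_pairing :
    forall x y : M, exists p : M, is_pair p x y;
  zf_union :
    forall x : M, exists u : M,
      forall z : M, z ∈ u <-> exists y : M, y ∈ x /\ z ∈ y;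
  zf_power :
    forall x : M, exists p : M, is_power p x;
  zf_infinity :
    exists w : M, inductive_set w;
  zf_separation :
    forall (p : formula) (e : nat -> M) (a : M), exists b : M,
      forall x : M, x ∈ b <-> x ∈ a /\ holds p (scons x e);
  zf_replacement :
    forall (p : formula) (e : nat -> M) (a : M),
      (forall x : M, x ∈ a -> exists! y : M, holds p (scons x (scons y e))) ->
      exists b : M, forall y : M,
        y ∈ b <-> exists x : M, x ∈ a /\ holds p (scons x (scons y e));
  zf_choice :
    forall a : M,
      (forall x : M, x ∈ a -> exists y : M, y ∈ x) ->
      (forall x y z : M, x ∈ a -> y ∈ a -> z ∈ x -> z ∈ y -> x = y) ->
      exists c : M, forall x : M, x ∈ a -> exists! y : M, y ∈ x /\ y ∈ c
}.

(** ** Ordinals, functions, cardinals *)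

Definition transitive_set {M : structure} (x : M) : Prop :=
  forall y : M, y ∈ x -> subset y x.

(* Linearity suffices for well-ordering, by foundation. *)
Definition ordinal {M : structure} (x : M) : Prop :=
  transitive_set x /\
  forall y z : M, y ∈ x -> z ∈ x -> y ∈ z \/ y = z \/ z ∈ y.

Definition ord_le {M : structure} (a b : M) : Prop := a ∈ b \/ a = b.

(* Kuratowski's {{a}, {a, b}}. *)
Definition is_opair {M : structure} (p a b : M) : Prop :=
  forall z : M, z ∈ p <-> is_pair z a a \/ is_pair z a b.

Definition rel {M : structure} (r a b : M) : Prop :=
  exists p : M, is_opair p a b /\ p ∈ r.

Definition partial_function {M : structure} (f A B : M) : Prop :=
  (forall p : M, p ∈ f ->
     exists a b : M, a ∈ A /\ b ∈ B /\ is_opair p a b) /\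
  (forall a b b' : M, rel f a b -> rel f a b' -> b = b').

Definition total_function {M : structure} (f A B : M) : Prop :=
  partial_function f A B /\ forall a : M, a ∈ A -> exists b : M, rel f a b.

Definition equinumerous {M : structure} (A B : M) : Prop :=
  exists f : M, total_function f A B /\
    (forall a a' b : M, rel f a b -> rel f a' b -> a = a') /\
    (forall b : M, b ∈ B -> exists a : M, rel f a b).

Definition is_omega {M : structure} (w : M) : Prop :=
  inductive_set w /\ forall v : M, inductive_set v -> subset w v.

Definition cardinal {M : structure} (k : M) : Prop :=
  ordinal k /\ forall a : M, a ∈ k -> ~ equinumerous a k.

(* Every function from a smaller ordinal into [k] is bounded in [k]. *)
Definition regular {M : structure} (k : M) : Prop :=
  forall a g : M, a ∈ k -> total_function g a k ->
    exists b : M, b ∈ k /\ forall x y : M, rel g x y -> y ∈ b.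

Definition strong_limit {M : structure} (k : M) : Prop :=
  forall a : M, a ∈ k ->
    exists p b : M, is_power p a /\ b ∈ k /\ equinumerous p b.

Definition inaccessible {M : structure} (k : M) : Prop :=
  cardinal k /\ (exists w : M, is_omega w /\ w ∈ k) /\
  regular k /\ strong_limit k.

(** [v] is V_a, by the recursion V_b = ⋃_{c < b} P(V_c), carried out by a
    function [h] with domain a + 1. *)
Definition is_V {M : structure} (a v : M) : Prop :=
  ordinal a /\
  exists h d B : M, is_succ d a /\ total_function h d B /\
    (forall b y : M, rel h b y ->
       forall z : M, z ∈ y <->
         exists c x : M, c ∈ b /\ rel h c x /\ subset z x) /\
    rel h a v.

(** ** Coded formulas and satisfaction inside [M]

    A structure is a domain [A : M] with membership and, for [R = Some f], also
    the graph of a partial function [f].  Variables are indexed by the elements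
    of [M]'s ω, and assignments are functions from ω to [A]. *)

Fixpoint is_num {M : structure} (n : nat) (x : M) : Prop :=
  match n with
  | 0 => is_empty x
  | S m => exists y : M, is_num m y /\ is_succ x y
  end.

Definition tagged {M : structure} (n : nat) (c x : M) : Prop :=
  exists t : M, is_num n t /\ is_opair c t x.

Definition tagged2 {M : structure} (n : nat) (c x y : M) : Prop :=
  exists p : M, is_opair p x y /\ tagged n c p.

Definition code_mem {M : structure} : M -> M -> M -> Prop := tagged2 0.
Definition code_eq {M : structure} : M -> M -> M -> Prop := tagged2 1.
Definition code_fun {M : structure} : M -> M -> M -> Prop := tagged2 2.
Definition code_neg {M : structure} : M -> M -> Prop := tagged 3.
Definition code_and {M : structure} : M -> M -> M -> Prop := tagged2 4.
Definition code_ex {M : structure} : M -> M -> M -> Prop := tagged2 5.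

(* [b] tells whether the language contains the function symbol. *)
Definition formula_closed {M : structure} (b : bool) (w C : M) : Prop :=
  (forall c i j : M, i ∈ w -> j ∈ w -> code_mem c i j -> c ∈ C) /\
  (forall c i j : M, i ∈ w -> j ∈ w -> code_eq c i j -> c ∈ C) /\
  (b = true ->
   forall c i j : M, i ∈ w -> j ∈ w -> code_fun c i j -> c ∈ C) /\
  (forall c p : M, p ∈ C -> code_neg c p -> c ∈ C) /\
  (forall c p q : M, p ∈ C -> q ∈ C -> code_and c p q -> c ∈ C) /\
  (forall c i p : M, i ∈ w -> p ∈ C -> code_ex c i p -> c ∈ C).

(** [F] is the set of all coded formulas of the language. *)
Definition is_formulas {M : structure} (b : bool) (F : M) : Prop :=
  exists w : M, is_omega w /\ formula_closed b w F /\
    forall C : M, formula_closed b w C -> subset F C.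

Definition has_fun {M : structure} (R : option M) : bool :=
  match R with Some _ => true | None => false end.

Definition fun_rel {M : structure} (R : option M) (x y : M) : Prop :=
  match R with Some f => rel f x y | None => False end.

(** Tarski's clauses: [T] relates a coded formula to an assignment exactly when
    the formula is true in (A, ∈, R) under the assignment. *)
Definition is_truth {M : structure} (A : M) (R : option M) (T : M) : Prop :=
  exists w F : M, is_omega w /\ is_formulas (has_fun R) F /\
  forall s : M, total_function s w A ->
    (forall c i j : M, i ∈ w -> j ∈ w -> code_mem c i j ->
       (rel T c s <-> exists x y : M, rel s i x /\ rel s j y /\ x ∈ y)) /\
    (forall c i j : M, i ∈ w -> j ∈ w -> code_eq c i j ->
       (rel T c s <-> exists x y : M, rel s i x /\ rel s j y /\ x = y)) /\
    (has_fun R = true ->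
     forall c i j : M, i ∈ w -> j ∈ w -> code_fun c i j ->
       (rel T c s <-> exists x y : M, rel s i x /\ rel s j y /\ fun_rel R x y)) /\
    (forall c p : M, p ∈ F -> code_neg c p -> (rel T c s <-> ~ rel T p s)) /\
    (forall c p q : M, p ∈ F -> q ∈ F -> code_and c p q ->
       (rel T c s <-> rel T p s /\ rel T q s)) /\
    (forall c i p : M, i ∈ w -> p ∈ F -> code_ex c i p ->
       (rel T c s <->
        exists s' : M, total_function s' w A /\
          (forall j x : M, j <> i -> (rel s' j x <-> rel s j x)) /\
          rel T p s')).

Definition satisfies {M : structure} (A : M) (R : option M) (c s : M) : Prop :=
  exists T : M, is_truth A R T /\ rel T c s.

(** (A, ∈, R) ≺ (B, ∈, S), for structures in the same language. *)
Definition elementary {M : structure} (A : M) (R : option M)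
    (B : M) (S : option M) : Prop :=
  has_fun R = has_fun S /\ subset A B /\
  forall w F c s : M, is_omega w -> is_formulas (has_fun R) F -> c ∈ F ->
    total_function s w A -> (satisfies A R c s <-> satisfies B S c s).

(** The binary relation [f] is definable without parameters in (A, ∈): the truth
    value of the formula [c] depends only on the variables 0 and 1. *)
Definition definable_in {M : structure} (A f : M) : Prop :=
  exists w F c : M, is_omega w /\ is_formulas false F /\ c ∈ F /\
    forall s i0 i1 x y : M, total_function s w A ->
      is_num 0 i0 -> is_num 1 i1 -> rel s i0 x -> rel s i1 y ->
      (satisfies A None c s <-> rel f x y).

(** ** Uplifting cardinals *)

Definition uplifting {M : structure} (k : M) : Prop :=
  inaccessible k /\
  forall th : M, ordinal th ->
    exists g Vk Vg : M, inaccessible g /\ ord_le th g /\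
      is_V k Vk /\ is_V g Vg /\ elementary Vk None Vg None /\ Vk <> Vg.

Definition uplifting_Menas {M : structure} (k f : M) : Prop :=
  partial_function f k k /\
  forall th : M, ordinal th ->
    exists g fs Vk Vg : M, inaccessible g /\ th ∈ g /\
      partial_function fs g g /\
      is_V k Vk /\ is_V g Vg /\ elementary Vk (Some f) Vg (Some fs) /\
      exists d : M, rel fs k d /\ ord_le th d.

(** ** Class functions *)

Definition ord_class_function {M : structure} (F : M -> M -> Prop) : Prop :=
  (forall a b : M, F a b -> ordinal a /\ ordinal b) /\
  (forall a : M, ordinal a -> exists! b : M, F a b).

Definition is_restriction {M : structure} (F : M -> M -> Prop) (k f : M) : Prop :=
  forall p : M, p ∈ f <-> exists a b : M, a ∈ k /\ F a b /\ is_opair p a b.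

(* Main.v *)
From Stdlib Require Import ClassicalEpsilon ProofIrrelevance FunctionalExtensionality.
From Stdlib Require Import Arith Lia.
Require Import Defs.

(** Call an inaccessible [g] a target of [b] when [V_b] is elementary in [V_g].  The
    function sends an ordinal [b] to the least strict upper bound of its targets, or
    to 0 if the targets of [b] are unbounded.  For inaccessible [g], and indeed for
    every limit [g > ω], the set [V_g] satisfies Zermelo's axioms and has a stage of the
    cumulative hierarchy at each of its ordinals.  This suffices to carry out the coding
    of formulas and Tarski's definition of truth inside [V_g], so being a target is
    absolute between the universe and [V_g].  Since an uplifting [k] has arbitrarily
    large targets, elementarity shows that [V_k] computes the function correctly on [k].
    Given an ordinal [th], take a target [g0 > th] of [k] and let [g] be the least target
    of [k] above [g0].  The largest target of [k] which [V_g] sees is [g0], so [V_g]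
    computes the value [g0 + 1 > th] at [k].  The expansions of [V_k] and [V_g] by the
    function are definable by one standard formula, so elementarity carries over to the
    expanded structures.  For the possibly nonstandard formulas of the model this is
    shown by induction inside the model, where only the existence of a translation into
    the language of [∈] is needed. *)

Definition witness {T : Type} {P : T -> Prop} (P_inhabited : exists x, P x) : T :=
  proj1_sig (constructive_indefinite_description P P_inhabited).

Lemma witness_spec {T : Type} {P : T -> Prop} (P_inhabited : exists x, P x) :
  P (witness P_inhabited).
Proof. exact (proj2_sig (constructive_indefinite_description P P_inhabited)). Qed.

(** * Definability with parameters *)

Definition lift_renaming (r : nat -> nat) (n : nat) : nat :=
  match n with 0 => 0 | S m => S (r m) end.

Fixpoint rename (r : nat -> nat) (p : formula) : formula :=
  match p with
  | Fmem i j => Fmem (r i) (r j)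
  | Feq i j => Feq (r i) (r j)
  | Fneg p => Fneg (rename r p)
  | Fand p q => Fand (rename r p) (rename r q)
  | Fex p => Fex (rename (lift_renaming r) p)
  end.

Lemma holds_rename {M : structure} (p : formula) :
  forall (r : nat -> nat) (e e' : nat -> M),
    (forall n, e (r n) = e' n) -> (holds (rename r p) e <-> holds p e').
Proof.
  induction p as [i j|i j|p IH|p IHp q IHq|p IH]; intros r e e' He; simpl.
  - rewrite !He; reflexivity.
  - rewrite !He; reflexivity.
  - rewrite (IH r e e' He); reflexivity.
  - rewrite (IHp r e e' He), (IHq r e e' He); reflexivity.
  - apply Morphisms_Prop.ex_iff_morphism; intros x.
    apply IH; intros [|n]; simpl; auto.
Qed.

Lemma holds_ext {M : structure} (p : formula) (e e' : nat -> M) :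
  (forall n, e n = e' n) -> (holds p e <-> holds p e').
Proof.
  intros He. apply functional_extensionality in He; subst; reflexivity.
Qed.

(** Definability is relative to a family of structures: a family with one member
    serves for the separation schema of a fixed model, and the family of all
    structures gives one formula which works in every structure. *)
Section Definability.
Context {I : Type} {Ms : I -> structure}.

Definition symbol : Type := (nat + (forall i : I, Ms i))%type.

Definition interpret (a : symbol) (i : I) (e : nat -> Ms i) : Ms i :=
  match a with inl n => e n | inr c => c i end.

Definition is_symbol (t : forall i : I, (nat -> Ms i) -> Ms i) : Prop :=
  exists a : symbol, forall i e, t i e = interpret a i e.

Definition definable (Q : forall i : I, (nat -> Ms i) -> Prop) : Prop :=
  exists (p : formula) (a : nat -> symbol), forall i e,
    holds p (fun n => interpret (a n) i e) <-> Q i e.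

Lemma is_symbol_variable (n : nat) : is_symbol (fun i e => e n).
Proof. exists (inl n); reflexivity. Qed.

Lemma is_symbol_parameter (c : forall i : I, Ms i) : is_symbol (fun i e => c i).
Proof. exists (inr c); reflexivity. Qed.

Lemma is_symbol_rename (t : forall i : I, (nat -> Ms i) -> Ms i) (r : nat -> nat) :
  is_symbol t -> is_symbol (fun i e => t i (fun n => e (r n))).
Proof.
  intros [[n|c] Ht]; [exists (inl (r n))|exists (inr c)];
    intros i e; rewrite Ht; reflexivity.
Qed.

Lemma definable_iff (Q Q' : forall i : I, (nat -> Ms i) -> Prop) :
  (forall i e, Q i e <-> Q' i e) -> definable Q -> definable Q'.
Proof.
  intros HQ [p [a Hp]]; exists p, a; intros i e. rewrite Hp; apply HQ.
Qed.

Lemma definable_subst (Q : forall i : I, (nat -> Ms i) -> Prop)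
    (t : nat -> forall i : I, (nat -> Ms i) -> Ms i) :
  definable Q -> (forall n, is_symbol (t n)) ->
  definable (fun i e => Q i (fun n => t n i e)).
Proof.
  intros [p [a Hp]] Ht.
  exists p, (fun n => match a n with inl m => witness (Ht m) | b => b end).
  intros i e. rewrite <- Hp. apply holds_ext. intros n.
  destruct (a n) as [m|c]; simpl; [|reflexivity].
  symmetry; apply (witness_spec (Ht m)).
Qed.

Lemma definable_mem (t u : forall i : I, (nat -> Ms i) -> Ms i) :
  is_symbol t -> is_symbol u -> definable (fun i e => t i e ∈ u i e).
Proof.
  intros [a Ha] [b Hb]. exists (Fmem 0 1), (scons a (fun _ => b)).
  intros i e; simpl. rewrite Ha, Hb; reflexivity.
Qed.

Lemma definable_eq (t u : forall i : I, (nat -> Ms i) -> Ms i) :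
  is_symbol t -> is_symbol u -> definable (fun i e => t i e = u i e).
Proof.
  intros [a Ha] [b Hb]. exists (Feq 0 1), (scons a (fun _ => b)).
  intros i e; simpl. rewrite Ha, Hb; reflexivity.
Qed.

Lemma definable_const (C : Prop) : definable (fun i e => C).
Proof.
  destruct (classic C) as [HC|HC].
  - exists (Feq 0 0), (fun _ => inl 0); simpl; tauto.
  - exists (Fneg (Feq 0 0)), (fun _ => inl 0); simpl; tauto.
Qed.

Lemma definable_not (Q : forall i : I, (nat -> Ms i) -> Prop) :
  definable Q -> definable (fun i e => ~ Q i e).
Proof.
  intros [p [a Hp]]. exists (Fneg p), a. intros i e; simpl.
  rewrite Hp; reflexivity.
Qed.

Lemma definable_and (Q Q' : forall i : I, (nat -> Ms i) -> Prop) :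
  definable Q -> definable Q' -> definable (fun i e => Q i e /\ Q' i e).
Proof.
  intros [p [a Hp]] [q [b Hq]].
  exists (Fand (rename (fun n => 2 * n) p) (rename (fun n => 2 * n + 1) q)),
    (fun n => if Nat.even n then a (Nat.div2 n) else b (Nat.div2 n)).
  intros i e; cbn [holds].
  rewrite (holds_rename p _ _ (fun n => interpret (a n) i e)),
    (holds_rename q _ _ (fun n => interpret (b n) i e)), Hp, Hq;
    [reflexivity| |]; intros n; cbv beta.
  - rewrite Nat.even_add, Nat.even_mul, Nat.add_1_r, Nat.div2_succ_double.
    reflexivity.
  - rewrite Nat.even_mul, Nat.div2_double; reflexivity.
Qed.

Lemma definable_ex (Q : forall i : I, (nat -> Ms i) -> Ms i -> Prop) :
  definable (fun i e => Q i (fun n => e (S n)) (e 0)) ->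
  definable (fun i e => exists x : Ms i, Q i e x).
Proof.
  intros [p [a Hp]].
  exists (Fex (rename (fun n => match a n with inl 0 => 0 | _ => S n end) p)),
    (fun n => match a n with inl (S m) => inl m | b => b end).
  intros i e; cbn [holds].
  apply Morphisms_Prop.ex_iff_morphism; intros x.
  rewrite (holds_rename p _ _ (fun n => interpret (a n) i (scons x e))).
  - apply (Hp i (scons x e)).
  - intros n. destruct (a n) as [[|m]|c] eqn:Han; simpl; rewrite ?Han; reflexivity.
Qed.

Lemma definable_or (Q Q' : forall i : I, (nat -> Ms i) -> Prop) :
  definable Q -> definable Q' -> definable (fun i e => Q i e \/ Q' i e).
Proof.
  intros HQ HQ'. apply (definable_iff (fun i e => ~ (~ Q i e /\ ~ Q' i e))).
  - intros i e; tauto.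
  - apply definable_not, definable_and; apply definable_not; assumption.
Qed.

Lemma definable_imp (Q Q' : forall i : I, (nat -> Ms i) -> Prop) :
  definable Q -> definable Q' -> definable (fun i e => Q i e -> Q' i e).
Proof.
  intros HQ HQ'. apply (definable_iff (fun i e => ~ (Q i e /\ ~ Q' i e))).
  - intros i e; tauto.
  - apply definable_not, definable_and; [|apply definable_not]; assumption.
Qed.

Lemma definable_all (Q : forall i : I, (nat -> Ms i) -> Ms i -> Prop) :
  definable (fun i e => Q i (fun n => e (S n)) (e 0)) ->
  definable (fun i e => forall x : Ms i, Q i e x).
Proof.
  intros HQ. apply (definable_iff (fun i e => ~ exists x : Ms i, ~ Q i e x)).
  - intros i e; split; [|intros Hall [x Hx]; auto].
    intros Hno x. apply NNPP; intros Hx; apply Hno; exists x; exact Hx.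
  - apply definable_not, (definable_ex (fun i e x => ~ Q i e x)), definable_not, HQ.
Qed.

Lemma definable_ex_lt (k : nat) (Q : nat -> forall i : I, (nat -> Ms i) -> Prop) :
  (forall n, definable (Q n)) -> definable (fun i e => exists n, n < k /\ Q n i e).
Proof.
  intros HQ; induction k as [|k IH].
  - apply (definable_iff (fun i e => False)); [|apply definable_const].
    intros i e; split; [tauto|intros [n [Hn _]]; lia].
  - apply (definable_iff (fun i e => (exists n, n < k /\ Q n i e) \/ Q k i e));
      [|apply definable_or; [exact IH|apply HQ]].
    intros i e; split.
    + intros [[n [Hn Hq]]|Hq]; [exists n|exists k]; (split; [lia|exact Hq]).
    + intros [n [Hn Hq]]. destruct (Nat.eq_dec n k) as [->|Hne]; [right; exact Hq|].
      left; exists n; split; [lia|exact Hq].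
Qed.

End Definability.

Notation uniformly_definable Q := (definable (I := structure) (Ms := fun N => N) Q).

(** A parameter [forall M : structure, M] cannot exist because a structure may be
    empty, so definability over all structures is parameter-free. *)
Lemma uniformly_definable_formula (Q : forall M : structure, (nat -> M) -> Prop) :
  uniformly_definable Q ->
  exists p : formula, forall (M : structure) (e : nat -> M), holds p e <-> Q M e.
Proof.
  intros [p [a Hp]].
  assert (Ha : forall n, exists m, a n = inl m).
  { intros n. destruct (a n) as [m|c]; [exists m; reflexivity|].
    destruct (c (Structure False (fun _ _ => False))). }
  exists (rename (fun n => witness (Ha n)) p). intros M e. rewrite <- Hp.
  apply holds_rename. intros n.
  exact (f_equal (fun b => interpret b M e) (eq_sym (witness_spec (Ha n)))).
Qed.

Notation definable_class P :=
  (definable (I := unit) (Ms := fun _ => _) (fun _ e => P (e 0))).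
Notation definable_relation P :=
  (definable (I := unit) (Ms := fun _ => _) (fun _ e => P (e 0) (e 1))).

Lemma definable_relation_formula {M : structure} (P : M -> M -> Prop) (o : M) :
  definable_relation P ->
  exists (p : formula) (e : nat -> M), forall x y, holds p (scons x (scons y e)) <-> P x y.
Proof.
  intros [p [a Hp]].
  exists (rename (fun n => match a n with inl 0 => 0 | inl 1 => 1 | _ => S (S n) end) p),
    (fun n => interpret (a n) tt (fun _ => o)).
  intros x y.
  rewrite (holds_rename p _ _
    (fun n => interpret (a n) tt (scons x (scons y (fun _ => o))))).
  - apply (Hp tt (scons x (scons y (fun _ => o)))).
  - intros n. destruct (a n) as [[|[|m]]|c] eqn:Han; simpl; rewrite ?Han; reflexivity.
Qed.

Lemma definable_relation_apply {M : structure} (P : M -> M -> Prop)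
    (t u : unit -> (nat -> M) -> M) :
  definable_relation P -> is_symbol (Ms := fun _ => M) t -> is_symbol (Ms := fun _ => M) u ->
  definable (Ms := fun _ => M) (fun (i : unit) e => P (t i e) (u i e)).
Proof.
  intros HP Ht Hu.
  apply (definable_subst (Ms := fun _ => M) (fun _ e => P (e 0) (e 1))
    (fun n => match n with 0 => t | _ => u end)); [exact HP|].
  intros [|n]; assumption.
Qed.

Create HintDb definability.

#[export] Hint Extern 0 (is_symbol _) => cbv beta; first
  [ apply is_symbol_variable
  | match goal with |- is_symbol (fun i e => ?c) =>
      exact (is_symbol_parameter (fun _ => c)) end
  | match goal with Ht : is_symbol ?t |- _ => exact Ht end
  | match goal with Ht : is_symbol ?t |- _ => exact (is_symbol_rename t _ Ht) end ]
  : definability.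

Ltac definability_step :=
  cbv beta;
  lazymatch goal with
  | |- is_symbol _ => auto 1 with definability nocore
  | |- definable (fun i e => _ ∈ _) => apply definable_mem
  | |- definable (fun i e => _ = _) => first [apply definable_eq | apply definable_const]
  | |- definable (fun i e => ~ _) => apply definable_not
  | |- definable (fun i e => _ /\ _) => apply definable_and
  | |- definable (fun i e => _ \/ _) => apply definable_or
  | |- definable (fun i e => exists x, _) => apply definable_ex
  | |- definable (fun i e => _ -> _) => first [apply definable_imp | apply definable_all]
  | |- definable (fun i e => forall x, _) => apply definable_all
  | P : ?A -> ?A -> Prop, HP : definable (fun _ e => ?P (e 0) (e 1))
      |- definable (fun i e => ?P _ _) => apply (definable_relation_apply P _ _ HP)
  | |- _ => first [assumption | solve [auto 2 with definability nocore] | apply definable_const]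
  end.

Ltac definability :=
  unfold is_opair, is_pair, is_power, is_succ, is_empty, subset, iff;
  repeat definability_step.

Section DefinableNotions.
Context {I : Type} {Ms : I -> structure}.
Implicit Types t u v : forall i : I, (nat -> Ms i) -> Ms i.

Lemma definable_rel t u v :
  is_symbol t -> is_symbol u -> is_symbol v ->
  definable (fun i e => rel (t i e) (u i e) (v i e)).
Proof. intros; unfold rel; definability. Qed.
#[local] Hint Resolve definable_rel : definability.

Lemma definable_ordinal t : is_symbol t -> definable (fun i e => ordinal (t i e)).
Proof. intros; unfold ordinal, transitive_set; definability. Qed.

Lemma definable_inductive_set t :
  is_symbol t -> definable (fun i e => inductive_set (t i e)).
Proof. intros; unfold inductive_set; definability. Qed.
#[local] Hint Resolve definable_ordinal definable_inductive_set : definability.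

Lemma definable_is_omega t : is_symbol t -> definable (fun i e => is_omega (t i e)).
Proof. intros; unfold is_omega; definability. Qed.

Lemma definable_total_function t u v :
  is_symbol t -> is_symbol u -> is_symbol v ->
  definable (fun i e => total_function (t i e) (u i e) (v i e)).
Proof. intros; unfold total_function, partial_function; definability. Qed.
#[local] Hint Resolve definable_is_omega definable_total_function : definability.

Lemma definable_is_V t u :
  is_symbol t -> is_symbol u -> definable (fun i e => is_V (t i e) (u i e)).
Proof. intros; unfold is_V; definability. Qed.

Lemma definable_inaccessible t :
  is_symbol t -> definable (fun i e => inaccessible (t i e)).
Proof.
  intros; unfold inaccessible, cardinal, regular, strong_limit, equinumerous;
    definability.
Qed.

Lemma definable_is_num n t : is_symbol t -> definable (fun i e => is_num n (t i e)).
Proof.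
  revert t; induction n as [|n IH]; intros t Ht; simpl; [definability|].
  apply definable_ex, definable_and; [apply IH|]; definability.
Qed.
#[local] Hint Resolve definable_is_num : definability.

Lemma definable_tagged n t u :
  is_symbol t -> is_symbol u -> definable (fun i e => tagged n (t i e) (u i e)).
Proof. intros; unfold tagged; definability. Qed.
#[local] Hint Resolve definable_tagged : definability.

Lemma definable_tagged2 n t u v :
  is_symbol t -> is_symbol u -> is_symbol v ->
  definable (fun i e => tagged2 n (t i e) (u i e) (v i e)).
Proof. intros; unfold tagged2; definability. Qed.
#[local] Hint Resolve definable_tagged2 : definability.

Lemma definable_formula_closed b t u :
  is_symbol t -> is_symbol u -> definable (fun i e => formula_closed b (t i e) (u i e)).
Proof.
  intros; unfold formula_closed, code_mem, code_eq, code_fun, code_neg, code_and,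
    code_ex; definability.
Qed.
#[local] Hint Resolve definable_formula_closed : definability.

Lemma definable_is_formulas b t :
  is_symbol t -> definable (fun i e => is_formulas b (t i e)).
Proof. intros; unfold is_formulas; definability. Qed.
#[local] Hint Resolve definable_is_formulas : definability.

Lemma definable_satisfies t u v :
  is_symbol t -> is_symbol u -> is_symbol v ->
  definable (fun i e => satisfies (t i e) None (u i e) (v i e)).
Proof.
  intros; unfold satisfies, is_truth, code_mem, code_eq, code_fun, code_neg, code_and,
    code_ex; cbn [has_fun fun_rel]; definability.
Qed.
#[local] Hint Resolve definable_satisfies : definability.

Lemma definable_elementary t u :
  is_symbol t -> is_symbol u ->
  definable (fun i e => elementary (t i e) None (u i e) None).
Proof. intros; unfold elementary; cbn [has_fun]; definability. Qed.

End DefinableNotions.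

#[export] Hint Resolve definable_rel definable_ordinal definable_inductive_set
  definable_is_omega definable_total_function definable_is_V definable_inaccessible
  definable_is_num definable_tagged definable_tagged2 definable_formula_closed
  definable_is_formulas definable_elementary : definability.

(** * Elementary set theory *)

(** The axioms of [ZFC] which also hold in [V_l] for every limit [l > ω], so that
    everything derived from them can be used inside [V_l] as well. *)
Class Zermelo (M : structure) : Prop := {
  extensionality :
    forall x y : M, (forall z : M, z ∈ x <-> z ∈ y) -> x = y;
  foundation :
    forall x : M, (exists y : M, y ∈ x) ->
      exists y : M, y ∈ x /\ forall z : M, z ∈ y -> ~ z ∈ x;
  pairing :
    forall x y : M, exists p : M, is_pair p x y;
  union :
    forall x : M, exists u : M, forall z : M, z ∈ u <-> exists y : M, y ∈ x /\ z ∈ y;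
  power :
    forall x : M, exists p : M, is_power p x;
  infinity :
    exists w : M, inductive_set w;
  separation_schema :
    forall (p : formula) (e : nat -> M) (a : M), exists b : M,
      forall x : M, x ∈ b <-> x ∈ a /\ holds p (scons x e)
}.

Section SetTheory.
Context {M : structure} {HM : Zermelo M}.
Implicit Types a b c d f g h k o p r s t u v w x y z A B C D : M.

Lemma separation (P : M -> Prop) a :
  definable_class P -> exists b, forall x, x ∈ b <-> x ∈ a /\ P x.
Proof.
  intros P_def.
  destruct (definable_relation_formula (fun x _ => P x) a) as (p & e & Hp);
    [exact P_def|].
  destruct (separation_schema p (scons a e) a) as [b Hb].
  exists b. intros x. rewrite Hb, Hp. reflexivity.
Qed.

Lemma eq_iff_mem_iff (P : M -> Prop) s :
  (forall z, z ∈ s <-> P z) -> forall x, (forall z, z ∈ x <-> P z) <-> x = s.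
Proof.
  intros Hs x. split; [|intros ->; exact Hs].
  intros Hx. apply extensionality; intros z. rewrite Hx, Hs. reflexivity.
Qed.

Lemma subset_refl x : subset x x.
Proof. intros z Hz; exact Hz. Qed.

Lemma subset_antisym x y : subset x y -> subset y x -> x = y.
Proof. intros Hxy Hyx. apply extensionality; split; auto. Qed.

Lemma empty_set_exists : exists o, is_empty o.
Proof. destruct infinity as [w [[o [Ho _]] _]]. exists o; exact Ho. Qed.

Definition empty_set : M := witness empty_set_exists.

Lemma mem_empty_set z : ~ z ∈ empty_set.
Proof. exact (witness_spec empty_set_exists z). Qed.

Lemma is_empty_iff x : is_empty x <-> x = empty_set.
Proof.
  split; [|intros ->; exact mem_empty_set].
  intros Hx. apply subset_antisym; intros z Hz.
  - destruct (Hx z Hz).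
  - destruct (mem_empty_set z Hz).
Qed.

Definition unordered_pair x y : M := witness (pairing x y).

Lemma mem_unordered_pair x y z : z ∈ unordered_pair x y <-> z = x \/ z = y.
Proof. exact (witness_spec (pairing x y) z). Qed.

Lemma is_pair_iff p x y : is_pair p x y <-> p = unordered_pair x y.
Proof. exact (eq_iff_mem_iff _ _ (mem_unordered_pair x y) p). Qed.

Definition ordered_pair x y : M := unordered_pair (unordered_pair x x) (unordered_pair x y).

Lemma is_opair_iff p x y : is_opair p x y <-> p = ordered_pair x y.
Proof.
  apply (eq_iff_mem_iff (fun z => is_pair z x x \/ is_pair z x y)). intros z.
  unfold ordered_pair. rewrite mem_unordered_pair, !is_pair_iff. reflexivity.
Qed.

Lemma unordered_pair_inj x y x' y' :
  unordered_pair x y = unordered_pair x' y' -> (x = x' /\ y = y') \/ (x = y' /\ y = x').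
Proof.
  intros Heq.
  assert (Hmem : forall z, (z = x \/ z = y) <-> (z = x' \/ z = y')).
  { intros z. rewrite <- !mem_unordered_pair, Heq. reflexivity. }
  assert (Hx := proj1 (Hmem x) (or_introl eq_refl)).
  assert (Hy := proj1 (Hmem y) (or_intror eq_refl)).
  assert (Hx' := proj2 (Hmem x') (or_introl eq_refl)).
  assert (Hy' := proj2 (Hmem y') (or_intror eq_refl)).
  destruct Hx, Hy, Hx', Hy'; subst; auto.
Qed.

Lemma ordered_pair_inj x y x' y' :
  ordered_pair x y = ordered_pair x' y' -> x = x' /\ y = y'.
Proof.
  unfold ordered_pair. intros Heq.
  destruct (unordered_pair_inj _ _ _ _ Heq) as [[Hl Hr]|[Hl Hr]];
    apply unordered_pair_inj in Hl, Hr;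
    destruct Hl as [[? ?]|[? ?]], Hr as [[? ?]|[? ?]]; subst; auto.
Qed.

Lemma rel_iff r a b : rel r a b <-> ordered_pair a b ∈ r.
Proof.
  split.
  - intros [p [Hp Hr]]. apply is_opair_iff in Hp; subst; exact Hr.
  - intros Hr. exists (ordered_pair a b).
    split; [apply is_opair_iff; reflexivity|exact Hr].
Qed.

Definition power_set x : M := witness (power x).

Lemma mem_power_set x z : z ∈ power_set x <-> subset z x.
Proof. exact (witness_spec (power x) z). Qed.

Lemma is_power_iff p x : is_power p x <-> p = power_set x.
Proof. exact (eq_iff_mem_iff _ _ (mem_power_set x) p). Qed.

Definition union_set x : M := witness (union x).

Lemma mem_union_set x z : z ∈ union_set x <-> exists y, y ∈ x /\ z ∈ y.
Proof. exact (witness_spec (union x) z). Qed.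

Definition binary_union x y : M := union_set (unordered_pair x y).

Lemma mem_binary_union x y z : z ∈ binary_union x y <-> z ∈ x \/ z ∈ y.
Proof.
  unfold binary_union. rewrite mem_union_set. split.
  - intros (u & Hu & Hz). apply mem_unordered_pair in Hu as [-> | ->]; auto.
  - intros [Hz|Hz]; [exists x|exists y]; rewrite mem_unordered_pair; auto.
Qed.

Definition successor x : M := binary_union x (unordered_pair x x).

Lemma mem_successor x z : z ∈ successor x <-> z ∈ x \/ z = x.
Proof.
  unfold successor. rewrite mem_binary_union, mem_unordered_pair; tauto.
Qed.

Lemma mem_successor_self x : x ∈ successor x.
Proof. apply mem_successor; auto. Qed.

Lemma is_succ_iff y x : is_succ y x <-> y = successor x.
Proof. exact (eq_iff_mem_iff _ _ (mem_successor x) y). Qed.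

Lemma ordered_pair_mem_power x y C :
  x ∈ C -> y ∈ C -> ordered_pair x y ∈ power_set (power_set C).
Proof.
  intros Hx Hy. apply mem_power_set. intros z Hz. apply mem_power_set.
  apply mem_unordered_pair in Hz as [-> | ->]; intros u Hu;
    apply mem_unordered_pair in Hu as [-> | ->]; assumption.
Qed.

Lemma product_exists A B :
  exists D, forall p, p ∈ D <-> exists a b, a ∈ A /\ b ∈ B /\ is_opair p a b.
Proof.
  destruct (separation (fun p => exists a b, a ∈ A /\ b ∈ B /\ is_opair p a b)
    (power_set (power_set (binary_union A B)))) as [D HD]; [definability|].
  exists D. intros p. rewrite HD. split; [tauto|]. intros Hp; split; [|exact Hp].
  destruct Hp as (a & b & Ha & Hb & Hp). apply is_opair_iff in Hp; subst p.
  apply ordered_pair_mem_power; apply mem_binary_union; auto.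
Qed.

Definition product A B : M := witness (product_exists A B).

Lemma mem_product A B p :
  p ∈ product A B <-> exists a b, a ∈ A /\ b ∈ B /\ is_opair p a b.
Proof. exact (witness_spec (product_exists A B) p). Qed.

Lemma ordered_pair_mem_product A B a b :
  ordered_pair a b ∈ product A B <-> a ∈ A /\ b ∈ B.
Proof.
  rewrite mem_product. split.
  - intros (a' & b' & Ha & Hb & Heq).
    apply is_opair_iff, ordered_pair_inj in Heq as [-> ->]; auto.
  - intros [Ha Hb]. exists a, b. rewrite is_opair_iff. auto.
Qed.

(** ** Relations and functions *)

Lemma relation_exists (P : M -> M -> Prop) A B :
  definable_relation P ->
  exists r, subset r (product A B) /\ forall a b, rel r a b <-> a ∈ A /\ b ∈ B /\ P a b.
Proof.
  intros P_def.
  destruct (separation (fun p => exists a b, is_opair p a b /\ P a b) (product A B))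
    as [r Hr]; [definability|].
  exists r. split; [intros p Hp; apply Hr, Hp|].
  intros a b. rewrite rel_iff, Hr, ordered_pair_mem_product. split.
  - intros [[Ha Hb] (a' & b' & Heq & HP)].
    apply is_opair_iff, ordered_pair_inj in Heq as [-> ->]; auto.
  - intros (Ha & Hb & HP). split; [auto|]. exists a, b. rewrite is_opair_iff. auto.
Qed.

Lemma subset_product_rel r A B a b :
  subset r (product A B) -> rel r a b -> a ∈ A /\ b ∈ B.
Proof.
  intros Hr Hab. apply ordered_pair_mem_product, Hr, rel_iff, Hab.
Qed.

Lemma partial_function_iff f A B :
  partial_function f A B <->
  subset f (product A B) /\ forall a b b', rel f a b -> rel f a b' -> b = b'.
Proof.
  unfold partial_function. split; intros [f_pairs f_functional];
    (split; [|exact f_functional]); intros p Hp; apply mem_product, f_pairs, Hp.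
Qed.

Lemma partial_function_rel f A B a b :
  partial_function f A B -> rel f a b -> a ∈ A /\ b ∈ B.
Proof. intros [f_sub _]%partial_function_iff. exact (subset_product_rel f A B a b f_sub). Qed.

Lemma rel_iff_is_restriction (F : M -> M -> Prop) k f B :
  partial_function f k B -> (forall a b, rel f a b <-> a ∈ k /\ F a b) ->
  is_restriction F k f.
Proof.
  intros [f_pairs _] Hf p. split.
  - intros Hp. destruct (f_pairs p Hp) as (a & b & Ha & _ & Heq). exists a, b.
    split; [exact Ha|split; [|exact Heq]]. apply (Hf a b). exists p; auto.
  - intros (a & b & Ha & Hab & Heq). apply is_opair_iff in Heq; subst.
    apply rel_iff, Hf. auto.
Qed.

Lemma total_function_rel f A B a b : total_function f A B -> rel f a b -> a ∈ A /\ b ∈ B.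
Proof. intros [f_partial _]. exact (partial_function_rel f A B a b f_partial). Qed.

Lemma total_function_functional f A B a b b' :
  total_function f A B -> rel f a b -> rel f a b' -> b = b'.
Proof. intros [[_ f_functional] _]. apply f_functional. Qed.

Lemma total_function_widen f A B C :
  subset B C -> total_function f A B -> total_function f A C.
Proof.
  intros HBC [[f_pairs f_functional] f_total].
  split; [split|]; [|exact f_functional|exact f_total].
  intros p Hp. destruct (f_pairs p Hp) as (a & b & Ha & Hb & Heq). exists a, b; auto.
Qed.

Lemma partial_function_exists (P : M -> M -> Prop) A B :
  definable_relation P ->
  (forall a b b', a ∈ A -> P a b -> P a b' -> b = b') ->
  exists f, partial_function f A B /\ forall a b, rel f a b <-> a ∈ A /\ b ∈ B /\ P a b.
Proof.
  intros P_def P_functional.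
  destruct (relation_exists P A B P_def) as (f & f_sub & Hf).
  exists f. split; [|exact Hf]. apply partial_function_iff. split; [exact f_sub|].
  intros a b b' Hab Hab'. apply Hf in Hab, Hab'.
  apply (P_functional a); [apply Hab|apply Hab|apply Hab'].
Qed.

Lemma total_function_exists (P : M -> M -> Prop) A B :
  definable_relation P ->
  (forall a, a ∈ A -> exists! b, P a b) ->
  (forall a b, a ∈ A -> P a b -> b ∈ B) ->
  exists f, total_function f A B /\ forall a b, rel f a b <-> a ∈ A /\ P a b.
Proof.
  intros P_def P_total P_range.
  destruct (partial_function_exists P A B P_def) as (f & f_partial & Hf).
  { intros a b b' Ha Hab Hab'. destruct (P_total a Ha) as (b0 & _ & b0_unique).
    rewrite <- (b0_unique b Hab). apply b0_unique, Hab'. }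
  assert (Hf' : forall a b, rel f a b <-> a ∈ A /\ P a b).
  { intros a b. rewrite Hf. split; [tauto|]. intros [Ha Hab].
    split; [exact Ha|split; [exact (P_range a b Ha Hab)|exact Hab]]. }
  exists f. split; [split; [exact f_partial|]|exact Hf'].
  intros a Ha. destruct (P_total a Ha) as (b & Hab & _). exists b. apply Hf'; auto.
Qed.

Lemma constant_function_exists A B b :
  b ∈ B -> exists f, total_function f A B /\ forall a, a ∈ A -> rel f a b.
Proof.
  intros Hb.
  destruct (total_function_exists (fun _ y => y = b) A B) as (f & f_total & Hf).
  - definability.
  - intros a _. exists b. split; [reflexivity|congruence].
  - intros a y _ ->. exact Hb.
  - exists f. split; [exact f_total|]. intros a Ha. apply Hf; auto.
Qed.

Lemma update_exists s w A i x :
  total_function s w A -> i ∈ w -> x ∈ A ->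
  exists s', total_function s' w A /\ rel s' i x /\
    forall j y, j <> i -> (rel s' j y <-> rel s j y).
Proof.
  intros s_total Hi Hx.
  destruct (total_function_exists
    (fun j y => (j = i /\ y = x) \/ (j <> i /\ rel s j y)) w A) as (s' & s'_total & Hs').
  - definability.
  - intros j Hj. destruct (classic (j = i)) as [->|Hne].
    + exists x. split; [auto|]. intros y [[_ ->]|[Hne _]]; [reflexivity|contradiction].
    + destruct (proj2 s_total j Hj) as [y Hy]. exists y. split; [auto|].
      intros y' [[Heq _]|[_ Hy']]; [contradiction|].
      exact (total_function_functional s w A j y y' s_total Hy Hy').
  - intros j y _ [[_ ->]|[_ Hy]]; [exact Hx|].
    apply (total_function_rel s w A j y s_total Hy).
  - exists s'. split; [exact s'_total|split; [apply Hs'; auto|]].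
    intros j y Hne. rewrite Hs'. split; [tauto|]. intros Hy.
    split; [apply (total_function_rel s w A j y s_total Hy)|auto].
Qed.

Lemma function_space_exists A B : exists W, forall f, f ∈ W <-> total_function f A B.
Proof.
  destruct (separation (fun f => total_function f A B) (power_set (product A B)))
    as [W HW]; [definability|].
  exists W. intros f. rewrite HW. split; [tauto|]. intros f_total; split; [|exact f_total].
  apply mem_power_set. apply (partial_function_iff f A B), f_total.
Qed.

Definition function_space A B : M := witness (function_space_exists A B).

Lemma mem_function_space A B f : f ∈ function_space A B <-> total_function f A B.
Proof. exact (witness_spec (function_space_exists A B) f). Qed.

(* The union of all post-fixed points, as in the Knaster-Tarski theorem. *)
Lemma monotone_fixpoint_exists (Phi : (M -> M -> Prop) -> M -> M -> Prop) A B :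
  definable (I := unit) (Ms := fun _ => M) (fun _ e => Phi (rel (e 0)) (e 1) (e 2)) ->
  (forall R S : M -> M -> Prop, (forall a b, R a b -> S a b) ->
    forall a b, Phi R a b -> Phi S a b) ->
  exists r, forall a b, rel r a b <-> a ∈ A /\ b ∈ B /\ Phi (rel r) a b.
Proof.
  intros Phi_def Phi_mono.
  assert (Phi_def_at : forall t : nat -> unit -> (nat -> M) -> M,
    (forall n, is_symbol (Ms := fun _ => M) (t n)) ->
    definable (Ms := fun _ => M) (fun i e => Phi (rel (t 0 i e)) (t 1 i e) (t 2 i e))).
  { intros t. exact (definable_subst (Ms := fun _ => M) _ t Phi_def). }
  pose (postfixed Z := forall a b, rel Z a b -> a ∈ A /\ b ∈ B /\ Phi (rel Z) a b).
  destruct (relation_exists (fun a b => exists Z, postfixed Z /\ rel Z a b) A B)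
    as (r & _ & Hr).
  { apply definable_ex, definable_and; [|definability].
    do 2 apply definable_all.
    apply definable_imp, definable_and, definable_and; [definability..|].
    apply (Phi_def_at (fun n _ e => match n with 0 => e 2 | 1 => e 1 | _ => e 0 end)).
    intros [|[|n]]; apply is_symbol_variable. }
  assert (r_postfixed : postfixed r).
  { intros a b (Ha & Hb & Z & HZ & Hab)%Hr. split; [exact Ha|split; [exact Hb|]].
    apply (Phi_mono (rel Z)); [|apply HZ, Hab].
    intros a' b' Hab'. destruct (HZ a' b' Hab') as (Ha' & Hb' & _). apply Hr; eauto. }
  exists r. intros a b. split; [apply r_postfixed|]. intros (Ha & Hb & Hab).
  destruct (relation_exists (Phi (rel r)) A B) as (Z & _ & HZ).
  { apply (Phi_def_at (fun n _ e => match n with 0 => r | 1 => e 0 | _ => e 1 end)).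
    intros [|[|n]]; [apply (is_symbol_parameter (fun _ => r))|apply is_symbol_variable..]. }
  apply Hr. split; [exact Ha|split; [exact Hb|]]. exists Z. split; [|apply HZ; auto].
  intros a' b' (Ha' & Hb' & Hab')%HZ. split; [exact Ha'|split; [exact Hb'|]].
  apply (Phi_mono (rel r)); [|exact Hab'].
  intros c d Hcd. apply HZ, r_postfixed, Hcd.
Qed.

(** ** Ordinals *)

Lemma foundation_min (P : M -> Prop) a x :
  definable_class P -> x ∈ a -> P x ->
  exists y, y ∈ a /\ P y /\ forall z, z ∈ y -> z ∈ a -> ~ P z.
Proof.
  intros P_def Hx HPx. destruct (separation P a P_def) as [b Hb].
  destruct (foundation b) as (y & Hy & y_min); [exists x; apply Hb; auto|].
  apply Hb in Hy as [Hy HPy]. exists y. split; [exact Hy|split; [exact HPy|]].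
  intros z Hz Hza HPz. apply (y_min z Hz), Hb; auto.
Qed.

Lemma mem_asym x y : x ∈ y -> ~ y ∈ x.
Proof.
  intros Hxy Hyx. destruct (foundation (unordered_pair x y)) as (z & Hz & z_min).
  - exists x. apply mem_unordered_pair; auto.
  - apply mem_unordered_pair in Hz as [-> | ->].
    + apply (z_min y Hyx), mem_unordered_pair; auto.
    + apply (z_min x Hxy), mem_unordered_pair; auto.
Qed.

Lemma mem_irrefl x : ~ x ∈ x.
Proof. intros Hx. exact (mem_asym x x Hx Hx). Qed.

Lemma mem_no_3_cycle x y z : x ∈ y -> y ∈ z -> ~ z ∈ x.
Proof.
  intros Hxy Hyz Hzx.
  destruct (foundation (binary_union (unordered_pair x y) (unordered_pair z z)))
    as (u & Hu & u_min).
  - exists x. rewrite mem_binary_union, !mem_unordered_pair; auto.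
  - rewrite mem_binary_union, !mem_unordered_pair in Hu.
    destruct Hu as [[-> | ->]|[-> | ->]];
      [apply (u_min z Hzx)|apply (u_min x Hxy)|apply (u_min y Hyz)|apply (u_min y Hyz)];
      rewrite mem_binary_union, !mem_unordered_pair; auto.
Qed.

Lemma ordinal_mem a b : ordinal a -> b ∈ a -> ordinal b.
Proof.
  intros [a_trans a_linear] Hb. split.
  - intros y Hy z Hz.
    assert (Hya := a_trans b Hb y Hy). assert (Hza := a_trans y Hya z Hz).
    destruct (a_linear z b Hza Hb) as [Hzb|[->|Hbz]]; [exact Hzb| |].
    + destruct (mem_asym _ _ Hy Hz).
    + destruct (mem_no_3_cycle _ _ _ Hz Hy Hbz).
  - intros y z Hy Hz. apply a_linear; apply (a_trans b Hb); assumption.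
Qed.

Lemma ordinal_trans a b c : ordinal a -> b ∈ a -> c ∈ b -> c ∈ a.
Proof. intros [a_trans _] Hb Hc. exact (a_trans b Hb c Hc). Qed.

Lemma ordinal_le_trans a b c : ordinal c -> ord_le a b -> b ∈ c -> a ∈ c.
Proof.
  intros Hc [Hab| ->] Hb; [exact (ordinal_trans c b a Hc Hb Hab)|exact Hb].
Qed.

Lemma transitive_subset_ordinal a c :
  ordinal a -> transitive_set c -> subset c a -> ord_le c a.
Proof.
  intros Ha c_trans c_sub.
  destruct (classic (exists x, x ∈ a /\ ~ x ∈ c)) as [(x & Hxa & Hxc)|Hnone].
  - left. destruct (foundation_min (fun x => ~ x ∈ c) a x) as (m & Hma & Hmc & m_min);
      [definability|exact Hxa|exact Hxc|].
    replace c with m; [exact Hma|]. apply subset_antisym; intros z Hz.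
    + apply NNPP, m_min; [exact Hz|]. exact (ordinal_trans a m z Ha Hma Hz).
    + destruct (proj2 Ha m z Hma (c_sub z Hz)) as [Hmz|[->|Hzm]]; [|contradiction|exact Hzm].
      destruct Hmc. exact (c_trans z Hz m Hmz).
  - right. apply subset_antisym; [exact c_sub|]. intros x Hx.
    apply NNPP; intros Hxc; apply Hnone; exists x; auto.
Qed.

Lemma ordinal_trichotomy a b : ordinal a -> ordinal b -> a ∈ b \/ a = b \/ b ∈ a.
Proof.
  intros Ha Hb.
  destruct (separation (fun x => x ∈ b) a) as [c Hc]; [definability|].
  assert (c_trans : transitive_set c).
  { intros y [Hya Hyb]%Hc z Hz. apply Hc.
    split; [exact (ordinal_trans a y z Ha Hya Hz)|exact (ordinal_trans b y z Hb Hyb Hz)]. }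
  assert (Hca : ord_le c a).
  { apply transitive_subset_ordinal; auto. intros z Hz; apply Hc, Hz. }
  assert (Hcb : ord_le c b).
  { apply transitive_subset_ordinal; auto. intros z Hz; apply Hc, Hz. }
  destruct Hca as [Hca| ->], Hcb as [Hcb| ->]; auto.
  destruct (mem_irrefl c). apply Hc; auto.
Qed.

Lemma ordinal_not_mem a b : ordinal a -> ordinal b -> ~ a ∈ b -> subset b a.
Proof.
  intros Ha Hb Hab. destruct (ordinal_trichotomy a b Ha Hb) as [Hmem|[<-|Hba]];
    [contradiction|apply subset_refl|apply Ha, Hba].
Qed.

Lemma ordinal_max a b :
  ordinal a -> ordinal b -> exists c, (c = a \/ c = b) /\ ord_le a c /\ ord_le b c.
Proof.
  intros Ha Hb. unfold ord_le.
  destruct (ordinal_trichotomy a b Ha Hb) as [Hab|[Hab|Hba]]; eauto 10.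
Qed.

Lemma ordinal_empty_set : ordinal empty_set.
Proof.
  split; [intros y Hy|intros y z Hy]; destruct (mem_empty_set _ Hy).
Qed.

Lemma ordinal_successor a : ordinal a -> ordinal (successor a).
Proof.
  intros Ha. split.
  - intros y Hy z Hz. apply mem_successor; left.
    apply mem_successor in Hy as [Hy| ->]; [exact (ordinal_trans a y z Ha Hy Hz)|exact Hz].
  - intros y z Hy Hz. apply mem_successor in Hy, Hz.
    destruct Hy as [Hy| ->], Hz as [Hz| ->]; auto. apply Ha; assumption.
Qed.

Lemma ordinal_least (P : M -> Prop) a :
  definable_class P -> ordinal a -> P a ->
  exists b, ordinal b /\ P b /\ forall c, c ∈ b -> ~ P c.
Proof.
  intros P_def Ha HPa. assert (Hsa := ordinal_successor a Ha).
  destruct (foundation_min P (successor a) a) as (b & Hb & HPb & b_min);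
    [exact P_def|apply mem_successor_self|exact HPa|].
  exists b. split; [exact (ordinal_mem _ b Hsa Hb)|split; [exact HPb|]].
  intros c Hc. apply b_min; [exact Hc|]. exact (ordinal_trans _ b c Hsa Hb Hc).
Qed.

Lemma ordinal_ind (P : M -> Prop) :
  definable_class P -> (forall a, ordinal a -> (forall b, b ∈ a -> P b) -> P a) ->
  forall a, ordinal a -> P a.
Proof.
  intros P_def P_step a Ha. apply NNPP; intros HPa.
  destruct (ordinal_least (fun x => ~ P x) a) as (b & Hb & HPb & b_min);
    [apply definable_not, P_def|exact Ha|exact HPa|].
  apply HPb, P_step; [exact Hb|]. intros c Hc. apply NNPP, b_min, Hc.
Qed.

(** ** The natural numbers *)

Lemma inductive_set_iff w :
  inductive_set w <-> empty_set ∈ w /\ forall x, x ∈ w -> successor x ∈ w.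
Proof.
  unfold inductive_set. setoid_rewrite is_empty_iff. setoid_rewrite is_succ_iff. split.
  - intros [(o & -> & Ho) w_succ]. split; [exact Ho|]. intros x Hx.
    destruct (w_succ x Hx) as (y & -> & Hy). exact Hy.
  - intros [w_empty w_succ]. split; eauto.
Qed.

Lemma omega_exists : exists w, is_omega w.
Proof.
  destruct infinity as [w Hw].
  destruct (separation (fun x => forall v, inductive_set v -> x ∈ v) w) as [o Ho];
    [definability|].
  assert (Ho' : forall x, x ∈ o <-> forall v, inductive_set v -> x ∈ v).
  { intros x. rewrite Ho. split; [tauto|auto]. }
  exists o. split; [apply inductive_set_iff; split|].
  - apply Ho'. intros v v_ind. apply (proj1 (inductive_set_iff v) v_ind).
  - intros x Hx. apply Ho'. intros v v_ind. apply (proj1 (inductive_set_iff v) v_ind).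
    exact (proj1 (Ho' x) Hx v v_ind).
  - intros v v_ind x Hx. exact (proj1 (Ho' x) Hx v v_ind).
Qed.

Definition omega : M := witness omega_exists.

Lemma is_omega_omega : is_omega omega.
Proof. exact (witness_spec omega_exists). Qed.

Lemma is_omega_iff w : is_omega w <-> w = omega.
Proof.
  split; [|intros ->; exact is_omega_omega].
  intros [w_ind w_least]. destruct is_omega_omega as [omega_ind omega_least].
  apply subset_antisym; auto.
Qed.

Lemma exists_omega_mem_iff a : (exists w, is_omega w /\ w ∈ a) <-> omega ∈ a.
Proof.
  setoid_rewrite is_omega_iff. split; [intros (w & -> & Hw); exact Hw|eauto].
Qed.

Lemma empty_set_mem_omega : empty_set ∈ omega.
Proof. apply (proj1 (inductive_set_iff omega)), is_omega_omega. Qed.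

Lemma successor_mem_omega x : x ∈ omega -> successor x ∈ omega.
Proof. apply (proj1 (inductive_set_iff omega)), is_omega_omega. Qed.

Lemma omega_ind (P : M -> Prop) :
  definable_class P -> P empty_set ->
  (forall x, x ∈ omega -> P x -> P (successor x)) -> forall x, x ∈ omega -> P x.
Proof.
  intros P_def P_empty P_succ x Hx. destruct (separation P omega P_def) as [v Hv].
  apply Hv. apply (proj2 is_omega_omega v); [|exact Hx].
  apply inductive_set_iff. split.
  - apply Hv. split; [exact empty_set_mem_omega|exact P_empty].
  - intros y [Hy HPy]%Hv. apply Hv. split; [exact (successor_mem_omega y Hy)|auto].
Qed.

Lemma ordinal_mem_omega x : x ∈ omega -> ordinal x.
Proof.
  revert x. apply omega_ind; [definability|exact ordinal_empty_set|].
  intros x _. apply ordinal_successor.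
Qed.

Lemma ordinal_omega : ordinal omega.
Proof.
  split.
  - refine (omega_ind (fun y => subset y omega) _ _ _); [definability| |].
    + intros z Hz; destruct (mem_empty_set z Hz).
    + intros x Hx IH z Hz. apply mem_successor in Hz as [Hz| ->]; auto.
  - intros y z Hy Hz. apply ordinal_trichotomy; apply ordinal_mem_omega; assumption.
Qed.

Fixpoint numeral (n : nat) : M :=
  match n with 0 => empty_set | S m => successor (numeral m) end.

Lemma is_num_iff (n : nat) x : is_num n x <-> x = numeral n.
Proof.
  revert x; induction n as [|n IH]; intros x; simpl; [apply is_empty_iff|].
  split.
  - intros (y & Hy & Hx). apply IH in Hy; subst. apply is_succ_iff, Hx.
  - intros ->. exists (numeral n). split; [apply IH|apply is_succ_iff]; reflexivity.
Qed.

Lemma numeral_mem_omega (n : nat) : numeral n ∈ omega.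
Proof.
  induction n; simpl; [exact empty_set_mem_omega|apply successor_mem_omega; assumption].
Qed.

Lemma numeral_lt (m n : nat) : m < n -> numeral m ∈ numeral n.
Proof. induction 1; simpl; apply mem_successor; auto. Qed.

Lemma numeral_inj (m n : nat) : numeral m = numeral n -> m = n.
Proof.
  intros Heq. destruct (Nat.lt_total m n) as [Hlt|[Hmn|Hlt]]; [|exact Hmn|];
    apply numeral_lt in Hlt; rewrite Heq in Hlt; destruct (mem_irrefl _ Hlt).
Qed.

Lemma omega_finitely_bounded (u : nat -> M) (N : nat) :
  (forall n, u n ∈ omega) -> exists k, k ∈ omega /\ forall n, n < N -> u n ∈ k.
Proof.
  intros Hu. induction N as [|N (k & Hk & k_bound)].
  - exists empty_set. split; [exact empty_set_mem_omega|lia].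
  - destruct (ordinal_max k (u N)) as (m & m_eq & Hkm & Hum);
      [apply ordinal_mem_omega; auto..|].
    assert (Hm : m ∈ omega) by (destruct m_eq; subst; auto).
    assert (Hsm := ordinal_successor m (ordinal_mem_omega m Hm)).
    exists (successor m). split; [exact (successor_mem_omega m Hm)|].
    intros n Hn. destruct (Nat.eq_dec n N) as [->|Hne].
    + exact (ordinal_le_trans _ m _ Hsm Hum (mem_successor_self m)).
    + apply (ordinal_trans _ k); [exact Hsm| |apply k_bound; lia].
      exact (ordinal_le_trans _ m _ Hsm Hkm (mem_successor_self m)).
Qed.

End SetTheory.

(** * The cumulative hierarchy *)

Section Hierarchy.
Context {M : structure} {HM : Zermelo M}.
Implicit Types a b c d f g h k o p r s t u v w x y z A B C D : M.

Definition V_recursion h : Prop :=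
  forall b y, rel h b y ->
    forall z, z ∈ y <-> exists c x, c ∈ b /\ rel h c x /\ subset z x.

Lemma is_V_iff a v :
  is_V a v <->
  ordinal a /\ exists h B, total_function h (successor a) B /\ V_recursion h /\ rel h a v.
Proof.
  split.
  - intros (Ha & h & d & B & Hd & Hh). apply is_succ_iff in Hd; subst. eauto.
  - intros (Ha & h & B & Hh). split; [exact Ha|]. exists h, (successor a), B.
    split; [apply is_succ_iff; reflexivity|exact Hh].
Qed.

Lemma V_recursion_agree h h' d d' B B' :
  ordinal d -> ordinal d' -> total_function h d B -> total_function h' d' B' ->
  V_recursion h -> V_recursion h' ->
  forall b y y', rel h b y -> rel h' b y' -> y = y'.
Proof.
  intros Hd Hd' h_total h'_total h_rec h'_rec b y y' Hy Hy'.
  assert (Hb := ordinal_mem d b Hd (proj1 (total_function_rel _ _ _ _ _ h_total Hy))).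
  revert b Hb y y' Hy Hy'.
  apply (ordinal_ind (fun b => forall y y', rel h b y -> rel h' b y' -> y = y'));
    [definability|].
  intros b Hb IH y y' Hy Hy'.
  assert (Hbd := proj1 (total_function_rel _ _ _ _ _ h_total Hy)).
  assert (Hbd' := proj1 (total_function_rel _ _ _ _ _ h'_total Hy')).
  apply extensionality; intros z. rewrite (h_rec b y Hy), (h'_rec b y' Hy').
  split; intros (c & x & Hc & Hx & Hz); exists c.
  - destruct (proj2 h'_total c (ordinal_trans d' b c Hd' Hbd' Hc)) as [x' Hx'].
    exists x'. split; [exact Hc|split; [exact Hx'|]].
    rewrite <- (IH c Hc x x' Hx Hx'). exact Hz.
  - destruct (proj2 h_total c (ordinal_trans d b c Hd Hbd Hc)) as [x' Hx'].
    exists x'. split; [exact Hc|split; [exact Hx'|]].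
    rewrite (IH c Hc x' x Hx' Hx). exact Hz.
Qed.

Lemma is_V_ordinal a v : is_V a v -> ordinal a.
Proof. intros [Ha _]; exact Ha. Qed.

Lemma is_V_unique a v v' : is_V a v -> is_V a v' -> v = v'.
Proof.
  intros (Ha & h & B & h_total & h_rec & Hv)%is_V_iff
    (_ & h' & B' & h'_total & h'_rec & Hv')%is_V_iff.
  assert (Hsa := ordinal_successor a Ha).
  exact (V_recursion_agree h h' _ _ B B' Hsa Hsa h_total h'_total h_rec h'_rec
    a v v' Hv Hv').
Qed.

Lemma V_recursion_is_V h d B b y :
  ordinal d -> total_function h d B -> V_recursion h -> rel h b y -> is_V b y.
Proof.
  intros Hd h_total h_rec Hy.
  assert (Hb := proj1 (total_function_rel _ _ _ _ _ h_total Hy)).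
  assert (Hob := ordinal_mem d b Hd Hb).
  apply is_V_iff. split; [exact Hob|].
  destruct (total_function_exists (rel h) (successor b) B) as (h' & h'_total & Hh').
  - definability.
  - intros c Hc. destruct (proj2 h_total c) as [x Hx].
    { apply mem_successor in Hc as [Hc| ->]; [exact (ordinal_trans d b c Hd Hb Hc)|exact Hb]. }
    exists x. split; [exact Hx|]. intros x' Hx'.
    exact (total_function_functional h d B c x x' h_total Hx Hx').
  - intros c x _ Hx. apply (total_function_rel h d B c x h_total Hx).
  - exists h', B. split; [exact h'_total|split].
    + intros c x [Hc Hx]%Hh' z. rewrite (h_rec c x Hx).
      apply Morphisms_Prop.ex_iff_morphism; intros c'.
      apply Morphisms_Prop.ex_iff_morphism; intros x'. rewrite Hh'.
      assert (c' ∈ c -> c' ∈ successor b).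
      { apply ordinal_trans; [apply ordinal_successor, Hob|exact Hc]. }
      tauto.
    + apply Hh'. split; [apply mem_successor_self|exact Hy].
Qed.

Lemma is_V_below a v b : is_V a v -> b ∈ a -> exists u, is_V b u.
Proof.
  intros (Ha & h & B & h_total & h_rec & _)%is_V_iff Hb.
  destruct (proj2 h_total b) as [u Hu]; [apply mem_successor; auto|].
  exists u. exact (V_recursion_is_V h _ B b u (ordinal_successor a Ha) h_total h_rec Hu).
Qed.

Lemma mem_V a v z : is_V a v -> z ∈ v <-> exists c x, c ∈ a /\ is_V c x /\ subset z x.
Proof.
  intros HV. assert (HV' := HV).
  apply is_V_iff in HV' as (Ha & h & B & h_total & h_rec & Hv).
  assert (Hsa := ordinal_successor a Ha).
  assert (h_V := fun b y => V_recursion_is_V h _ B b y Hsa h_total h_rec).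
  rewrite (h_rec a v Hv).
  split; intros (c & x & Hc & Hx & Hz); exists c, x;
    (split; [exact Hc|split; [|exact Hz]]).
  - exact (h_V c x Hx).
  - destruct (proj2 h_total c) as [x' Hx']; [apply mem_successor; auto|].
    rewrite (is_V_unique c x x' Hx (h_V c x' Hx')). exact Hx'.
Qed.

Lemma V_mem_V a v b u : is_V a v -> is_V b u -> b ∈ a -> u ∈ v.
Proof.
  intros Hv Hu Hb. apply (mem_V a v u Hv). exists b, u.
  split; [exact Hb|split; [exact Hu|apply subset_refl]].
Qed.

Lemma V_transitive a v : is_V a v -> transitive_set v.
Proof.
  intros Hv y Hy z Hz.
  apply (mem_V a v y Hv) in Hy as (c & x & Hc & Hx & Hyx).
  apply Hyx, (mem_V c x z Hx) in Hz as (c' & x' & Hc' & Hx' & Hz').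
  apply (mem_V a v z Hv). exists c', x'.
  split; [exact (ordinal_trans a c c' (is_V_ordinal a v Hv) Hc Hc')|auto].
Qed.

Lemma V_subset_closed a v x y : is_V a v -> x ∈ v -> subset y x -> y ∈ v.
Proof.
  intros Hv Hx Hyx. apply (mem_V a v x Hv) in Hx as (c & u & Hc & Hu & Hxu).
  apply (mem_V a v y Hv). exists c, u.
  split; [exact Hc|split; [exact Hu|]]. intros z Hz; auto.
Qed.

Lemma V_union_set a v x : is_V a v -> x ∈ v -> union_set x ∈ v.
Proof.
  intros Hv (c & u & Hc & Hu & Hxu)%(mem_V a v x Hv).
  apply (V_subset_closed a v u _ Hv (V_mem_V a v c u Hv Hu Hc)).
  intros z (y & Hy & Hz)%mem_union_set. exact (V_transitive c u Hu y (Hxu y Hy) z Hz).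
Qed.

Lemma V_subset_V a v b u : is_V a v -> is_V b u -> ord_le b a -> subset u v.
Proof.
  intros Hv Hu [Hb| ->].
  - apply (V_transitive a v Hv). exact (V_mem_V a v b u Hv Hu Hb).
  - rewrite (is_V_unique a u v Hu Hv). apply subset_refl.
Qed.

Lemma ordinal_subset_V a v : is_V a v -> subset a v.
Proof.
  intros Hv. assert (Ha := is_V_ordinal a v Hv). revert a Ha v Hv.
  apply (ordinal_ind (fun a => forall v, is_V a v -> subset a v)); [definability|].
  intros a Ha IH v Hv b Hb. destruct (is_V_below a v b Hv Hb) as [u Hu].
  apply (mem_V a v b Hv). exists b, u. auto.
Qed.

Lemma ordinal_mem_V a v x : is_V a v -> ordinal x -> x ∈ v <-> x ∈ a.
Proof.
  intros Hv Hx. split; [|apply (ordinal_subset_V a v Hv)].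
  assert (Ha := is_V_ordinal a v Hv). revert a Ha v Hv x Hx.
  apply (ordinal_ind (fun a => forall v, is_V a v -> forall x, ordinal x ->
    x ∈ v -> x ∈ a)); [definability|].
  intros a Ha IH v Hv x Hx Hxv.
  apply (mem_V a v x Hv) in Hxv as (c & u & Hc & Hu & Hxu).
  apply NNPP; intros Hxa.
  assert (Hcx : c ∈ x) by exact (ordinal_not_mem x a Hx Ha Hxa c Hc).
  apply (mem_irrefl c), (IH c Hc u Hu c); [exact (ordinal_mem a c Ha Hc)|].
  exact (Hxu c Hcx).
Qed.

Lemma V_recursion_exists a v :
  ordinal a -> (forall b, b ∈ a -> exists u, is_V b u) ->
  (forall z, z ∈ v <-> exists c x, c ∈ a /\ is_V c x /\ subset z x) ->
  exists h, total_function h (successor a) (power_set v) /\ V_recursion h /\ rel h a v.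
Proof.
  intros Ha V_below Hv.
  destruct (total_function_exists (fun b y => (b ∈ a /\ is_V b y) \/ (b = a /\ y = v))
    (successor a) (power_set v)) as (h & h_total & Hh).
  - definability.
  - intros b [Hb| ->]%mem_successor.
    + destruct (V_below b Hb) as [u Hu]. exists u. split; [auto|].
      intros u' [[_ Hu']|[-> _]]; [exact (is_V_unique b u u' Hu Hu')|].
      destruct (mem_irrefl a Hb).
    + exists v. split; [auto|]. intros u [[Haa _]|[_ ->]]; [|reflexivity].
      destruct (mem_irrefl a Haa).
  - intros b y _ Hby. apply mem_power_set. intros z Hz.
    destruct Hby as [[Hb Hy]|[_ ->]]; [|exact Hz].
    apply Hv. exists b, y. split; [exact Hb|split; [exact Hy|]].
    exact (V_transitive b y Hy z Hz).
  - assert (Hh' : forall b y, rel h b y <-> (b ∈ a /\ is_V b y) \/ (b = a /\ y = v)).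
    { intros b y. rewrite Hh, mem_successor. tauto. }
    exists h. split; [exact h_total|split; [|apply Hh'; auto]].
    intros b y Hby%Hh' z.
    assert (Hy : (z ∈ y <-> exists c x, c ∈ b /\ is_V c x /\ subset z x) /\
      forall c, c ∈ b -> c ∈ a).
    { destruct Hby as [[Hb Hy]|[-> ->]]; [|split; [apply Hv|auto]].
      split; [exact (mem_V b y z Hy)|intros c; exact (ordinal_trans a b c Ha Hb)]. }
    destruct Hy as [-> Hba].
    split; intros (c & x & Hc & Hx & Hz); exists c, x;
      (split; [exact Hc|split; [|exact Hz]]).
    + apply Hh'. auto.
    + apply Hh' in Hx as [[_ Hx]|[-> _]]; [exact Hx|].
      destruct (mem_irrefl a (Hba a Hc)).
Qed.

Lemma V_recursion_of_is_V a v :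
  is_V a v ->
  exists h, total_function h (successor a) (power_set v) /\ V_recursion h /\ rel h a v.
Proof.
  intros Hv. apply V_recursion_exists; [exact (is_V_ordinal a v Hv)| |].
  - intros b. exact (is_V_below a v b Hv).
  - intros z. exact (mem_V a v z Hv).
Qed.

(** ** Limit stages *)

Definition limit_ordinal a : Prop := ordinal a /\ forall b, b ∈ a -> successor b ∈ a.

Lemma limit_ordinal_omega : limit_ordinal omega.
Proof. split; [exact ordinal_omega|exact successor_mem_omega]. Qed.

Section LimitStage.
Context (l U : M) (l_limit : limit_ordinal l) (HU : is_V l U).

Lemma limit_V_power_set x : x ∈ U -> power_set x ∈ U.
Proof.
  intros (c & u & Hc & Hu & Hxu)%(mem_V l U x HU).
  destruct (is_V_below l U (successor c) HU) as [u' Hu']; [apply l_limit, Hc|].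
  apply (V_subset_closed l U u' _ HU).
  - exact (V_mem_V l U _ u' HU Hu' (proj2 l_limit c Hc)).
  - intros z Hz%mem_power_set. apply (mem_V _ u' z Hu'). exists c, u.
    split; [apply mem_successor_self|split; [exact Hu|intros y Hy; auto]].
Qed.

Lemma limit_V_binary_union x y : x ∈ U -> y ∈ U -> binary_union x y ∈ U.
Proof.
  intros (c & u & Hc & Hu & Hxu)%(mem_V l U x HU) (d & v & Hd & Hv & Hyv)%(mem_V l U y HU).
  destruct (ordinal_max c d) as (m & m_eq & Hcm & Hdm);
    [eapply ordinal_mem; [apply l_limit|eassumption]..|].
  assert (Hm : m ∈ l) by (destruct m_eq; subst; assumption).
  destruct (is_V_below l U m HU Hm) as [q Hq].
  apply (V_subset_closed l U q _ HU (V_mem_V l U m q HU Hq Hm)).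
  intros z [Hz|Hz]%mem_binary_union.
  - exact (V_subset_V m q c u Hq Hu Hcm z (Hxu z Hz)).
  - exact (V_subset_V m q d v Hq Hv Hdm z (Hyv z Hz)).
Qed.

Lemma limit_V_unordered_pair x y : x ∈ U -> y ∈ U -> unordered_pair x y ∈ U.
Proof.
  assert (singleton_mem : forall x, x ∈ U -> unordered_pair x x ∈ U).
  { intros w Hw. apply (V_subset_closed l U (power_set w) _ HU).
    - exact (limit_V_power_set w Hw).
    - intros z Hz. apply mem_power_set.
      apply mem_unordered_pair in Hz as [-> | ->]; apply subset_refl. }
  intros Hx Hy.
  apply (V_subset_closed l U (binary_union (unordered_pair x x) (unordered_pair y y)) _ HU).
  - apply limit_V_binary_union; auto.
  - intros z Hz%mem_unordered_pair. rewrite mem_binary_union, !mem_unordered_pair. tauto.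
Qed.

Lemma limit_V_ordered_pair x y : ordered_pair x y ∈ U <-> x ∈ U /\ y ∈ U.
Proof.
  split.
  - intros Hxy. assert (Hpair : unordered_pair x y ∈ U).
    { apply (V_transitive l U HU _ Hxy), mem_unordered_pair; auto. }
    split; apply (V_transitive l U HU _ Hpair), mem_unordered_pair; auto.
  - intros [Hx Hy]. apply limit_V_unordered_pair; apply limit_V_unordered_pair; assumption.
Qed.

Lemma limit_V_successor x : x ∈ U -> successor x ∈ U.
Proof.
  intros Hx. apply limit_V_binary_union; [exact Hx|].
  apply limit_V_unordered_pair; exact Hx.
Qed.

Lemma limit_V_product A B : A ∈ U -> B ∈ U -> product A B ∈ U.
Proof.
  intros HA HB.
  apply (V_subset_closed l U (power_set (power_set (binary_union A B))) _ HU).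
  - apply limit_V_power_set, limit_V_power_set, limit_V_binary_union; assumption.
  - intros p (a & b & Ha & Hb & Hp)%mem_product. apply is_opair_iff in Hp; subst.
    apply ordered_pair_mem_power; apply mem_binary_union; auto.
Qed.

Lemma limit_V_partial_function f A B :
  A ∈ U -> B ∈ U -> partial_function f A B -> f ∈ U.
Proof.
  intros HA HB [f_sub _]%partial_function_iff.
  exact (V_subset_closed l U _ f HU (limit_V_product A B HA HB) f_sub).
Qed.

End LimitStage.

(** ** Inaccessible cardinals *)

Lemma inaccessible_ordinal k : inaccessible k -> ordinal k.
Proof. intros [[Hk _] _]; exact Hk. Qed.

Lemma inaccessible_omega k : inaccessible k -> omega ∈ k.
Proof. intros [_ [Hk _]]. apply exists_omega_mem_iff, Hk. Qed.

(* If [k = b + 1], the function [0 |-> b] on 1 is unbounded in [k]. *)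
Lemma inaccessible_limit k : inaccessible k -> limit_ordinal k.
Proof.
  intros Hk. assert (Ho := inaccessible_ordinal k Hk). split; [exact Ho|].
  intros b Hb.
  destruct (transitive_subset_ordinal k (successor b) Ho) as [Hsb|Hsb].
  - apply ordinal_successor, (ordinal_mem k b Ho Hb).
  - intros z [Hz| ->]%mem_successor; [exact (ordinal_trans k b z Ho Hb Hz)|exact Hb].
  - exact Hsb.
  - exfalso. destruct (constant_function_exists (numeral 1) k b Hb) as (g & g_total & Hg).
    assert (k_omega := inaccessible_omega k Hk). destruct Hk as (_ & _ & k_regular & _).
    destruct (k_regular (numeral 1) g) as (m & Hm & m_bound).
    + exact (ordinal_trans k omega _ Ho k_omega (numeral_mem_omega 1)).
    + exact g_total.
    + assert (Hbm : b ∈ m) by exact (m_bound _ b (Hg _ (numeral_lt 0 1 (le_n 1)))).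
      rewrite <- Hsb in Hm. apply mem_successor in Hm as [Hmb| ->].
      * exact (mem_asym b m Hbm Hmb).
      * exact (mem_irrefl b Hbm).
Qed.

End Hierarchy.

(** Unlike replacement, this also holds in [V_l] for every limit [l > ω]. *)
Class Ranked (M : structure) : Prop :=
  V_exists : forall a : M, ordinal a -> exists v : M, is_V a v.

Section ReplacementInZFC.
Context {M : structure} (HZFC : ZFC M).

#[local] Instance ZFC_Zermelo : Zermelo M.
Proof. destruct HZFC; constructor; assumption. Qed.

Lemma replacement (P : M -> M -> Prop) (a : M) :
  definable_relation P -> (forall x, x ∈ a -> exists! y, P x y) ->
  exists b, forall y, y ∈ b <-> exists x, x ∈ a /\ P x y.
Proof.
  intros P_def P_functional.
  destruct (definable_relation_formula P a P_def) as (p & e & Hp).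
  destruct (zf_replacement M HZFC p e a) as [b Hb].
  - intros x Hx. destruct (P_functional x Hx) as (y & Hy & y_unique).
    exists y. split; [apply Hp, Hy|]. intros y' Hy'. apply y_unique, Hp, Hy'.
  - exists b. intros y. rewrite Hb.
    apply Morphisms_Prop.ex_iff_morphism; intros x. rewrite Hp. reflexivity.
Qed.

Lemma ZFC_Ranked : Ranked M.
Proof.
  unfold Ranked. apply ordinal_ind; [definability|].
  intros a Ha IH.
  destruct (replacement is_V a) as [R HR]; [definability| |].
  { intros c Hc. destruct (IH c Hc) as [x Hx]. exists x.
    split; [exact Hx|intros x'; exact (is_V_unique c x x' Hx)]. }
  destruct (separation (fun z => exists c x, c ∈ a /\ is_V c x /\ subset z x)
    (power_set (union_set R))) as [v Hv]; [definability|].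
  exists v. apply is_V_iff. split; [exact Ha|].
  destruct (V_recursion_exists a v Ha IH) as [h Hh]; [|exists h, (power_set v); exact Hh].
  intros z. rewrite Hv. split; [tauto|]. intros Hz; split; [|exact Hz].
  destruct Hz as (c & x & Hc & Hx & Hz). apply mem_power_set. intros y Hy.
  apply mem_union_set. exists x. split; [apply HR; eauto|auto].
Qed.

End ReplacementInZFC.

(** * Coded formulas and truth *)

(** The three kinds of atomic formulas, with tags 0 for [∈], 1 for [=] and 2 for the
    graph of the function, are treated uniformly. *)
Definition atom_kinds (b : bool) : nat := if b then 3 else 2.

Lemma atom_kinds_bounds (b : bool) : 2 <= atom_kinds b <= 3.
Proof. destruct b; simpl; lia. Qed.

Section CodedFormulas.
Context {M : structure} {HM : Zermelo M} {HR : Ranked M}.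
Implicit Types a c d f g h k i j o p q r s t u v w x y z A B C D F : M.

Definition mk_atom (n : nat) i j : M := ordered_pair (numeral n) (ordered_pair i j).
Definition mk_neg p : M := ordered_pair (numeral 3) p.
Definition mk_and p q : M := ordered_pair (numeral 4) (ordered_pair p q).
Definition mk_ex i p : M := ordered_pair (numeral 5) (ordered_pair i p).

Lemma tagged_iff (n : nat) c x : tagged n c x <-> c = ordered_pair (numeral n) x.
Proof.
  unfold tagged. setoid_rewrite is_num_iff. setoid_rewrite is_opair_iff.
  split; [intros (t & -> & Hc); exact Hc|eauto].
Qed.

Lemma tagged2_iff (n : nat) c x y :
  tagged2 n c x y <-> c = ordered_pair (numeral n) (ordered_pair x y).
Proof.
  unfold tagged2. setoid_rewrite is_opair_iff. setoid_rewrite tagged_iff.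
  split; [intros (p & -> & Hc); exact Hc|eauto].
Qed.

Lemma code_mem_iff c i j : code_mem c i j <-> c = mk_atom 0 i j.
Proof. exact (tagged2_iff 0 c i j). Qed.

Lemma code_eq_iff c i j : code_eq c i j <-> c = mk_atom 1 i j.
Proof. exact (tagged2_iff 1 c i j). Qed.

Lemma code_fun_iff c i j : code_fun c i j <-> c = mk_atom 2 i j.
Proof. exact (tagged2_iff 2 c i j). Qed.

Lemma code_neg_iff c p : code_neg c p <-> c = mk_neg p.
Proof. exact (tagged_iff 3 c p). Qed.

Lemma code_and_iff c p q : code_and c p q <-> c = mk_and p q.
Proof. exact (tagged2_iff 4 c p q). Qed.

Lemma code_ex_iff c i p : code_ex c i p <-> c = mk_ex i p.
Proof. exact (tagged2_iff 5 c i p). Qed.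

Ltac rewrite_codes :=
  setoid_rewrite code_mem_iff; setoid_rewrite code_eq_iff; setoid_rewrite code_fun_iff;
  setoid_rewrite code_neg_iff; setoid_rewrite code_and_iff; setoid_rewrite code_ex_iff.

Record closed_under_constructors (b : bool) w C : Prop := {
  closed_atom : forall (n : nat) i j,
    n < atom_kinds b -> i ∈ w -> j ∈ w -> mk_atom n i j ∈ C;
  closed_neg : forall p, p ∈ C -> mk_neg p ∈ C;
  closed_and : forall p q, p ∈ C -> q ∈ C -> mk_and p q ∈ C;
  closed_ex : forall i p, i ∈ w -> p ∈ C -> mk_ex i p ∈ C
}.

Lemma formula_closed_iff (b : bool) w C :
  formula_closed b w C <-> closed_under_constructors b w C.
Proof.
  unfold formula_closed. rewrite_codes. split.
  - intros (mem_closed & eq_closed & fun_closed & neg_closed & and_closed & ex_closed).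
    split.
    + intros n i j Hn Hi Hj. destruct n as [|[|n]];
        [apply (mem_closed _ i j)|apply (eq_closed _ i j)|]; auto.
      destruct b; simpl in Hn; [|lia].
      destruct n; [apply (fun_closed eq_refl _ i j); auto|lia].
    + intros p Hp. exact (neg_closed _ p Hp eq_refl).
    + intros p q Hp Hq. exact (and_closed _ p q Hp Hq eq_refl).
    + intros i p Hi Hp. exact (ex_closed _ i p Hi Hp eq_refl).
  - intros [atom_closed neg_closed and_closed ex_closed].
    assert (kinds := atom_kinds_bounds b).
    split; [|split; [|split; [|split; [|split]]]].
    + intros c i j Hi Hj ->. apply atom_closed; auto; lia.
    + intros c i j Hi Hj ->. apply atom_closed; auto; lia.
    + intros -> c i j Hi Hj ->. apply atom_closed; auto.
    + intros c p Hp ->. exact (neg_closed p Hp).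
    + intros c p q Hp Hq ->. exact (and_closed p q Hp Hq).
    + intros c i p Hi Hp ->. exact (ex_closed i p Hi Hp).
Qed.

Lemma formula_closed_V (b : bool) l U :
  limit_ordinal l -> is_V l U -> subset omega U -> formula_closed b omega U.
Proof.
  intros l_limit HU omega_sub. apply formula_closed_iff.
  assert (Hn : forall n, numeral n ∈ U) by (intros n; apply omega_sub, numeral_mem_omega).
  split; intros; repeat apply (limit_V_ordered_pair l U l_limit HU), conj; auto.
Qed.

Lemma formulas_exist (b : bool) : exists F, is_formulas b F.
Proof.
  destruct (V_exists omega ordinal_omega) as [v Hv].
  assert (v_closed : formula_closed b omega v).
  { apply (formula_closed_V b omega v limit_ordinal_omega Hv).
    exact (ordinal_subset_V omega v Hv). }
  destruct (separation (fun x => forall C, formula_closed b omega C -> x ∈ C) v)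
    as [F HF]; [definability|].
  assert (HF' : forall x, x ∈ F <-> forall C, formula_closed b omega C -> x ∈ C).
  { intros x. rewrite HF. split; [tauto|auto]. }
  exists F, omega. split; [exact is_omega_omega|]. split.
  - apply formula_closed_iff. split; intros; apply HF'; intros C C_closed;
      apply formula_closed_iff in C_closed as C_constr;
      [apply (closed_atom _ _ _ C_constr)|apply (closed_neg _ _ _ C_constr)
      |apply (closed_and _ _ _ C_constr)|apply (closed_ex _ _ _ C_constr)];
      try assumption; apply HF'; assumption.
  - intros C C_closed x Hx. exact (proj1 (HF' x) Hx C C_closed).
Qed.

Definition formulas (b : bool) : M := witness (formulas_exist b).

Lemma is_formulas_formulas (b : bool) : is_formulas b (formulas b).
Proof. exact (witness_spec (formulas_exist b)). Qed.

Lemma formulas_closed (b : bool) : closed_under_constructors b omega (formulas b).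
Proof.
  destruct (is_formulas_formulas b) as (w & Hw & F_closed & _).
  apply is_omega_iff in Hw; subst. apply formula_closed_iff, F_closed.
Qed.

Lemma formulas_least (b : bool) C :
  closed_under_constructors b omega C -> subset (formulas b) C.
Proof.
  destruct (is_formulas_formulas b) as (w & Hw & _ & F_least).
  apply is_omega_iff in Hw; subst. intros C_closed. apply F_least, formula_closed_iff, C_closed.
Qed.

Lemma is_formulas_iff (b : bool) F : is_formulas b F <-> F = formulas b.
Proof.
  split; [|intros ->; apply is_formulas_formulas].
  intros (w & Hw & F_closed & F_least). apply is_omega_iff in Hw; subst.
  apply subset_antisym.
  - apply F_least, formula_closed_iff, formulas_closed.
  - apply formulas_least, formula_closed_iff, F_closed.
Qed.

Lemma formula_ind (b : bool) (P : M -> Prop) :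
  definable_class P ->
  (forall (n : nat) i j, n < atom_kinds b -> i ∈ omega -> j ∈ omega -> P (mk_atom n i j)) ->
  (forall p, p ∈ formulas b -> P p -> P (mk_neg p)) ->
  (forall p q, p ∈ formulas b -> q ∈ formulas b -> P p -> P q -> P (mk_and p q)) ->
  (forall i p, i ∈ omega -> p ∈ formulas b -> P p -> P (mk_ex i p)) ->
  forall c, c ∈ formulas b -> P c.
Proof.
  intros P_def P_atom P_neg P_and P_ex.
  destruct (separation P (formulas b) P_def) as [C HC].
  assert (C_closed : closed_under_constructors b omega C).
  { destruct (formulas_closed b) as [F_atom F_neg F_and F_ex]. split.
    - intros n i j Hn Hi Hj. apply HC. split; [apply F_atom|apply P_atom]; assumption.
    - intros p [Hp HPp]%HC. apply HC. split; [apply F_neg|apply P_neg]; assumption.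
    - intros p q [Hp HPp]%HC [Hq HPq]%HC. apply HC.
      split; [apply F_and|apply P_and]; assumption.
    - intros i p Hi [Hp HPp]%HC. apply HC. split; [apply F_ex|apply P_ex]; assumption. }
  intros c Hc. apply HC. exact (formulas_least b C C_closed c Hc).
Qed.

Definition assignment A s : Prop := total_function s omega A.

Definition agree_off i s s' : Prop := forall j x, j <> i -> (rel s' j x <-> rel s j x).

Definition atomic_relation (R : option M) (n : nat) x y : Prop :=
  match n with 0 => x ∈ y | 1 => x = y | _ => fun_rel R x y end.

Definition atom_holds (R : option M) (n : nat) i j s : Prop :=
  exists x y, rel s i x /\ rel s j y /\ atomic_relation R n x y.

Record tarski A (R : option M) T : Prop := {
  tarski_atom : forall s (n : nat) i j,
    assignment A s -> n < atom_kinds (has_fun R) -> i ∈ omega -> j ∈ omega ->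
    (rel T (mk_atom n i j) s <-> atom_holds R n i j s);
  tarski_neg : forall s p,
    assignment A s -> p ∈ formulas (has_fun R) ->
    (rel T (mk_neg p) s <-> ~ rel T p s);
  tarski_and : forall s p q,
    assignment A s -> p ∈ formulas (has_fun R) -> q ∈ formulas (has_fun R) ->
    (rel T (mk_and p q) s <-> rel T p s /\ rel T q s);
  tarski_ex : forall s i p,
    assignment A s -> i ∈ omega -> p ∈ formulas (has_fun R) ->
    (rel T (mk_ex i p) s <->
     exists s', assignment A s' /\ agree_off i s s' /\ rel T p s')
}.

Lemma is_truth_iff A (R : option M) T : is_truth A R T <-> tarski A R T.
Proof.
  unfold is_truth. rewrite_codes. split.
  - intros (w & F & Hw & HF & T_clauses).
    apply is_omega_iff in Hw. apply is_formulas_iff in HF. subst w F.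
    split; intros s.
    + intros n i j Hs Hn Hi Hj.
      destruct (T_clauses s Hs) as (T_mem & T_eq & T_fun & _).
      destruct n as [|[|n]]; [apply T_mem; auto|apply T_eq; auto|].
      destruct (has_fun R); simpl in Hn; [|lia]. destruct n; [apply T_fun; auto|lia].
    + intros p Hs Hp. apply (T_clauses s Hs); auto.
    + intros p q Hs Hp Hq. apply (T_clauses s Hs); auto.
    + intros i p Hs Hi Hp. apply (T_clauses s Hs); auto.
  - intros [T_atom T_neg T_and T_ex]. exists omega, (formulas (has_fun R)).
    split; [exact is_omega_omega|split; [apply is_formulas_formulas|]].
    assert (kinds := atom_kinds_bounds (has_fun R)).
    intros s Hs. split; [|split; [|split; [|split; [|split]]]].
    + intros c i j Hi Hj ->. apply (T_atom s 0); auto; lia.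
    + intros c i j Hi Hj ->. apply (T_atom s 1); auto; lia.
    + intros Hfun c i j Hi Hj ->. apply (T_atom s 2); auto. rewrite Hfun; simpl; lia.
    + intros c p Hp ->. exact (T_neg s p Hs Hp).
    + intros c p q Hp Hq ->. exact (T_and s p q Hs Hp Hq).
    + intros c i p Hi Hp ->. exact (T_ex s i p Hs Hi Hp).
Qed.

(** ** Existence of truth *)

Section TruthExists.
Context (A : M) (R : option M).

Definition assignments : M := function_space omega A.

(* [X] is the set of assignments satisfying [c], given these sets for the immediate
   subformulas of [c]. *)
Definition value_clause (V : M -> M -> Prop) c X : Prop :=
  (exists n : nat, n < atom_kinds (has_fun R) /\
     exists i j, i ∈ omega /\ j ∈ omega /\ tagged2 n c i j /\
       forall s, s ∈ X <-> s ∈ assignments /\ atom_holds R n i j s) \/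
  (exists p Y, V p Y /\ code_neg c p /\ forall s, s ∈ X <-> s ∈ assignments /\ ~ s ∈ Y) \/
  (exists p q Y Z, V p Y /\ V q Z /\ code_and c p q /\
     forall s, s ∈ X <-> s ∈ Y /\ s ∈ Z) \/
  (exists i p Y, i ∈ omega /\ V p Y /\ code_ex c i p /\
     forall s, s ∈ X <-> s ∈ assignments /\ exists s', s' ∈ Y /\ agree_off i s s').

Definition truth_values r : Prop :=
  forall c X, rel r c X <->
    c ∈ formulas (has_fun R) /\ X ∈ power_set assignments /\ value_clause (rel r) c X.

Lemma definable_atom_holds (n : nat) (t u v : unit -> (nat -> M) -> M) :
  is_symbol (Ms := fun _ => M) t -> is_symbol (Ms := fun _ => M) u ->
  is_symbol (Ms := fun _ => M) v ->
  definable (Ms := fun _ => M)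
    (fun (x : unit) e => atom_holds R n (t x e) (u x e) (v x e)).
Proof.
  intros. unfold atom_holds, atomic_relation, fun_rel.
  destruct n as [|[|n]], R; definability.
Qed.
#[local] Hint Resolve definable_atom_holds : definability.

Lemma truth_values_exist : exists r, truth_values r.
Proof.
  apply monotone_fixpoint_exists.
  - unfold value_clause, code_neg, code_and, code_ex, agree_off.
    apply definable_or; [apply definable_ex_lt; intros n|]; definability.
  - intros V V' HV c X [Hatom|[(p & Y & HY & Hc)|[(p & q & Y & Z & HY & HZ & Hc)|
      (i & p & Y & Hi & HY & Hc)]]]; unfold value_clause.
    + left; exact Hatom.
    + right; left. exists p, Y; auto.
    + right; right; left. exists p, q, Y, Z; auto.
    + right; right; right. exists i, p, Y; auto.
Qed.

Section TruthValues.
Context (r : M) (r_values : truth_values r).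

Lemma value_subset c X : rel r c X -> subset X assignments.
Proof. intros (_ & HX & _)%r_values. apply mem_power_set, HX. Qed.

Ltac invert_code :=
  unfold mk_atom, mk_neg, mk_and, mk_ex in *;
  repeat match goal with
  | Heq : ordered_pair _ _ = ordered_pair _ _ |- _ =>
      apply ordered_pair_inj in Heq as [? ?]
  | Heq : numeral _ = numeral _ |- _ => apply numeral_inj in Heq
  end;
  subst; try discriminate; pose proof (atom_kinds_bounds (has_fun R)); try lia.

Ltac invert_value HX :=
  apply r_values in HX as (_ & _ &
    [(?n & ?Hn & ?i & ?j & ?Hi & ?Hj & ?Hc & ?HX)
    |[(?p & ?Y & ?HY & ?Hc & ?HX)
    |[(?p & ?q & ?Y & ?Z & ?HY & ?HZ & ?Hc & ?HX)
    |(?i & ?p & ?Y & ?Hi & ?HY & ?Hc & ?HX)]]]);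
  [apply tagged2_iff in Hc|apply code_neg_iff in Hc|apply code_and_iff in Hc
  |apply code_ex_iff in Hc]; invert_code.

Lemma value_atom (n : nat) i j X :
  n < atom_kinds (has_fun R) -> i ∈ omega -> j ∈ omega ->
  (rel r (mk_atom n i j) X <->
   forall s, s ∈ X <-> s ∈ assignments /\ atom_holds R n i j s).
Proof.
  intros Hn Hi Hj. split.
  - intros HX. invert_value HX; auto.
  - intros HX. apply r_values.
    split; [exact (closed_atom _ _ _ (formulas_closed _) n i j Hn Hi Hj)|split].
    + apply mem_power_set. intros s Hs. apply HX, Hs.
    + left. exists n. split; [exact Hn|]. exists i, j. rewrite tagged2_iff. auto.
Qed.

Lemma value_neg p X :
  p ∈ formulas (has_fun R) ->
  (rel r (mk_neg p) X <->
   exists Y, rel r p Y /\ forall s, s ∈ X <-> s ∈ assignments /\ ~ s ∈ Y).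
Proof.
  intros Hp. split.
  - intros HX. invert_value HX; eauto.
  - intros (Y & HY & HX). apply r_values.
    split; [exact (closed_neg _ _ _ (formulas_closed _) p Hp)|split].
    + apply mem_power_set. intros s Hs. apply HX, Hs.
    + right; left. exists p, Y. rewrite code_neg_iff. auto.
Qed.

Lemma value_and p q X :
  p ∈ formulas (has_fun R) -> q ∈ formulas (has_fun R) ->
  (rel r (mk_and p q) X <->
   exists Y Z, rel r p Y /\ rel r q Z /\ forall s, s ∈ X <-> s ∈ Y /\ s ∈ Z).
Proof.
  intros Hp Hq. split.
  - intros HX. invert_value HX; eauto.
  - intros (Y & Z & HY & HZ & HX). apply r_values.
    split; [exact (closed_and _ _ _ (formulas_closed _) p q Hp Hq)|split].
    + apply mem_power_set. intros s Hs. apply (value_subset p Y HY), HX, Hs.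
    + right; right; left. exists p, q, Y, Z. rewrite code_and_iff. auto.
Qed.

Lemma value_ex i p X :
  i ∈ omega -> p ∈ formulas (has_fun R) ->
  (rel r (mk_ex i p) X <->
   exists Y, rel r p Y /\ forall s, s ∈ X <->
     s ∈ assignments /\ exists s', s' ∈ Y /\ agree_off i s s').
Proof.
  intros Hi Hp. split.
  - intros HX. invert_value HX; eauto.
  - intros (Y & HY & HX). apply r_values.
    split; [exact (closed_ex _ _ _ (formulas_closed _) i p Hi Hp)|split].
    + apply mem_power_set. intros s Hs. apply HX, Hs.
    + right; right; right. exists i, p, Y. rewrite code_ex_iff. auto.
Qed.

Lemma value_exists_unique c : c ∈ formulas (has_fun R) -> exists! X, rel r c X.
Proof.
  assert (comprehension : forall (P : M -> Prop) B, definable_class P ->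
    exists! X, forall s, s ∈ X <-> s ∈ B /\ P s).
  { intros P B P_def. destruct (separation P B P_def) as [X HX]. exists X.
    split; [exact HX|]. intros X' HX'. symmetry. exact (proj1 (eq_iff_mem_iff _ X HX X') HX'). }
  revert c. apply formula_ind.
  - unfold unique. definability.
  - intros n i j Hn Hi Hj.
    destruct (comprehension (atom_holds R n i j) assignments) as (X & HX & X_unique);
      [definability|].
    exists X. split; [apply value_atom; assumption|].
    intros X' HX'. apply X_unique, value_atom; assumption.
  - intros p Hp (Y & HY & Y_unique).
    destruct (comprehension (fun s => ~ s ∈ Y) assignments) as (X & HX & X_unique);
      [definability|].
    exists X. split; [apply (value_neg p X Hp); eauto|].
    intros X' (Y' & HY' & HX')%(value_neg p X' Hp). rewrite <- (Y_unique Y' HY') in HX'.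
    exact (X_unique X' HX').
  - intros p q Hp Hq (Y & HY & Y_unique) (Z & HZ & Z_unique).
    destruct (comprehension (fun s => s ∈ Z) Y) as (X & HX & X_unique); [definability|].
    exists X. split; [apply (value_and p q X Hp Hq); eauto|].
    intros X' (Y' & Z' & HY' & HZ' & HX')%(value_and p q X' Hp Hq).
    rewrite <- (Y_unique Y' HY'), <- (Z_unique Z' HZ') in HX'. exact (X_unique X' HX').
  - intros i p Hi Hp (Y & HY & Y_unique).
    destruct (comprehension (fun s => exists s', s' ∈ Y /\ agree_off i s s') assignments)
      as (X & HX & X_unique); [unfold agree_off; definability|].
    exists X. split; [apply (value_ex i p X Hi Hp); eauto|].
    intros X' (Y' & HY' & HX')%(value_ex i p X' Hi Hp). rewrite <- (Y_unique Y' HY') in HX'.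
    exact (X_unique X' HX').
Qed.

Lemma tarski_of_values T :
  (forall c s, rel T c s <->
     c ∈ formulas (has_fun R) /\ s ∈ assignments /\ exists X, rel r c X /\ s ∈ X) ->
  tarski A R T.
Proof.
  intros HT.
  assert (HT' : forall c X s, rel r c X -> (rel T c s <-> s ∈ X)).
  { intros c X s HX. rewrite HT.
    assert (Hc := proj1 (proj1 (r_values c X) HX)). split.
    - intros (_ & _ & X' & HX' & Hs). destruct (value_exists_unique c Hc) as (X0 & _ & unique).
      rewrite <- (unique X HX), (unique X' HX'). exact Hs.
    - intros Hs. split; [exact Hc|split; [exact (value_subset c X HX s Hs)|eauto]]. }
  assert (value_of : forall c, c ∈ formulas (has_fun R) -> exists X, rel r c X).
  { intros c Hc. destruct (value_exists_unique c Hc) as (X & HX & _). exists X; exact HX. }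
  destruct (formulas_closed (has_fun R)) as [F_atom F_neg F_and F_ex]. split.
  - intros s n i j Hs%mem_function_space Hn Hi Hj.
    destruct (value_of _ (F_atom n i j Hn Hi Hj)) as [X HX].
    rewrite (HT' _ X s HX), (proj1 (value_atom n i j X Hn Hi Hj) HX s). tauto.
  - intros s p Hs%mem_function_space Hp. destruct (value_of _ (F_neg p Hp)) as [X HX].
    rewrite (HT' _ X s HX). apply (value_neg p X Hp) in HX as (Y & HY & HX).
    rewrite (HT' p Y s HY), (HX s). tauto.
  - intros s p q _ Hp Hq. destruct (value_of _ (F_and p q Hp Hq)) as [X HX].
    rewrite (HT' _ X s HX). apply (value_and p q X Hp Hq) in HX as (Y & Z & HY & HZ & HX).
    rewrite (HT' p Y s HY), (HT' q Z s HZ), (HX s). reflexivity.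
  - intros s i p Hs%mem_function_space Hi Hp.
    destruct (value_of _ (F_ex i p Hi Hp)) as [X HX].
    rewrite (HT' _ X s HX). apply (value_ex i p X Hi Hp) in HX as (Y & HY & HX).
    rewrite (HX s). split.
    + intros (_ & s' & Hs' & Hagree). exists s'.
      split; [apply mem_function_space, (value_subset p Y HY), Hs'|].
      split; [exact Hagree|apply (HT' p Y s' HY), Hs'].
    + intros (s' & _ & Hagree & Hs'). split; [exact Hs|]. exists s'.
      split; [apply (HT' p Y s' HY), Hs'|exact Hagree].
Qed.

End TruthValues.

Lemma tarski_exists : exists T, tarski A R T.
Proof.
  destruct truth_values_exist as [r r_values].
  destruct (relation_exists (fun c s => exists X, rel r c X /\ s ∈ X)
    (formulas (has_fun R)) assignments) as (T & _ & HT); [definability|].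
  exists T. exact (tarski_of_values r r_values T HT).
Qed.

End TruthExists.

(** ** Comparing truth relations *)

Section SameTruth.
Context (A : M) (R R' : option M) (T T' : M).
Context (HT : tarski A R T) (HT' : tarski A R' T').

Definition same_truth c c' : Prop := forall s, assignment A s -> (rel T c s <-> rel T' c' s).

Lemma same_truth_atom (n : nat) i j :
  n < atom_kinds (has_fun R) -> n < atom_kinds (has_fun R') ->
  (forall x y, atomic_relation R n x y <-> atomic_relation R' n x y) ->
  i ∈ omega -> j ∈ omega -> same_truth (mk_atom n i j) (mk_atom n i j).
Proof.
  intros Hn Hn' Hrel Hi Hj s Hs.
  rewrite (tarski_atom _ _ _ HT), (tarski_atom _ _ _ HT') by assumption.
  unfold atom_holds. setoid_rewrite Hrel. reflexivity.
Qed.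

Lemma same_truth_neg p p' :
  p ∈ formulas (has_fun R) -> p' ∈ formulas (has_fun R') ->
  same_truth p p' -> same_truth (mk_neg p) (mk_neg p').
Proof.
  intros Hp Hp' p_same s Hs.
  rewrite (tarski_neg _ _ _ HT), (tarski_neg _ _ _ HT'), (p_same s Hs) by assumption.
  reflexivity.
Qed.

Lemma same_truth_and p p' q q' :
  p ∈ formulas (has_fun R) -> p' ∈ formulas (has_fun R') ->
  q ∈ formulas (has_fun R) -> q' ∈ formulas (has_fun R') ->
  same_truth p p' -> same_truth q q' -> same_truth (mk_and p q) (mk_and p' q').
Proof.
  intros Hp Hp' Hq Hq' p_same q_same s Hs.
  rewrite (tarski_and _ _ _ HT), (tarski_and _ _ _ HT'), (p_same s Hs), (q_same s Hs)
    by assumption.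
  reflexivity.
Qed.

Lemma same_truth_ex i p p' :
  i ∈ omega -> p ∈ formulas (has_fun R) -> p' ∈ formulas (has_fun R') ->
  same_truth p p' -> same_truth (mk_ex i p) (mk_ex i p').
Proof.
  intros Hi Hp Hp' p_same s Hs.
  rewrite (tarski_ex _ _ _ HT), (tarski_ex _ _ _ HT') by assumption.
  apply Morphisms_Prop.ex_iff_morphism; intros s'.
  split; intros (Hs' & Hagree & Hps'); (split; [exact Hs'|split; [exact Hagree|]]);
    apply (p_same s' Hs'), Hps'.
Qed.

End SameTruth.

Lemma tarski_unique A (R : option M) T T' :
  tarski A R T -> tarski A R T' ->
  forall c, c ∈ formulas (has_fun R) -> same_truth A T T' c c.
Proof.
  intros HT HT'. apply formula_ind.
  - unfold same_truth, assignment. definability.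
  - intros n i j Hn Hi Hj. apply (same_truth_atom A R R); auto. reflexivity.
  - intros p Hp. apply (same_truth_neg A R R); assumption.
  - intros p q Hp Hq. apply (same_truth_and A R R); assumption.
  - intros i p Hi Hp. apply (same_truth_ex A R R); assumption.
Qed.

Lemma satisfies_iff A (R : option M) T c s :
  tarski A R T -> c ∈ formulas (has_fun R) -> assignment A s ->
  (satisfies A R c s <-> rel T c s).
Proof.
  intros HT Hc Hs. split.
  - intros (T' & HT' & Hcs). apply is_truth_iff in HT'.
    apply (tarski_unique A R T T' HT HT' c Hc s Hs), Hcs.
  - intros Hcs. exists T. split; [apply is_truth_iff, HT|exact Hcs].
Qed.

Lemma elementary_iff A (R : option M) B (S : option M) :
  has_fun R = has_fun S ->
  (elementary A R B S <->
   subset A B /\ forall c s, c ∈ formulas (has_fun R) -> assignment A s ->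
     (satisfies A R c s <-> satisfies B S c s)).
Proof.
  intros Hlang. split.
  - intros (_ & A_sub & Hsat). split; [exact A_sub|]. intros c s Hc Hs.
    exact (Hsat omega _ c s is_omega_omega (is_formulas_formulas _) Hc Hs).
  - intros [A_sub Hsat]. split; [exact Hlang|split; [exact A_sub|]].
    intros w F c s Hw HF. apply is_omega_iff in Hw. apply is_formulas_iff in HF.
    subst. apply Hsat.
Qed.

End CodedFormulas.

(** * Standard formulas inside a set structure *)

Definition substructure {M : structure} (A : M) : structure :=
  Structure {x : M | x ∈ A} (fun x y => proj1_sig x ∈ proj1_sig y).

Definition val {M : structure} {A : M} (x : substructure A) : M := proj1_sig x.

Definition element {M : structure} {A : M} (x : M) (Hx : x ∈ A) : substructure A :=
  exist (fun x => x ∈ A) x Hx.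

Lemma val_mem {M : structure} {A : M} (x : substructure A) : val x ∈ A.
Proof. exact (proj2_sig x). Qed.

Lemma val_surj {M : structure} {A : M} (x : M) :
  x ∈ A -> exists x' : substructure A, val x' = x.
Proof. intros Hx. exists (element x Hx). reflexivity. Qed.

Lemma val_inj {M : structure} {A : M} (x y : substructure A) : val x = val y -> x = y.
Proof.
  destruct x as [x Hx], y as [y Hy]. apply subset_eq_compat.
Qed.

Fixpoint relativize (d : nat) (r : nat -> nat) (p : formula) : formula :=
  match p with
  | Fmem i j => Fmem (r i) (r j)
  | Feq i j => Feq (r i) (r j)
  | Fneg p => Fneg (relativize d r p)
  | Fand p q => Fand (relativize d r p) (relativize d r q)
  | Fex p => Fex (Fand (Fmem 0 (S d)) (relativize (S d) (lift_renaming r) p))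
  end.

Lemma holds_relativize {M : structure} {A : M} (p : formula) :
  forall (d : nat) (r : nat -> nat) (e : nat -> M) (e' : nat -> substructure A),
    e d = A -> (forall n, e (r n) = val (e' n)) ->
    (holds (relativize d r p) e <-> holds p e').
Proof.
  induction p as [i j|i j|p IH|p IHp q IHq|p IH]; intros d r e e' Hd He; simpl.
  - rewrite !He; reflexivity.
  - rewrite !He. split; [apply val_inj|congruence].
  - rewrite (IH d r e e' Hd He); reflexivity.
  - rewrite (IHp d r e e' Hd He), (IHq d r e e' Hd He); reflexivity.
  - assert (IH' : forall x, holds (relativize (S d) (lift_renaming r) p) (scons (val x) e)
      <-> holds p (scons x e')).
    { intros x. apply IH; [exact Hd|intros [|n]; simpl; auto]. }
    rewrite Hd. split.
    + intros (x & Hx & Hp). exists (element x Hx). apply IH', Hp.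
    + intros (x & Hp). exists (val x). split; [apply val_mem|apply IH', Hp].
Qed.

Lemma definable_relation_substructure {M : structure} {A : M}
    (Q : substructure A -> substructure A -> Prop) :
  definable_relation Q ->
  definable_relation (fun x y : M => exists x' y', x = val x' /\ y = val y' /\ Q x' y').
Proof.
  intros [p [a Hp]].
  pose (b n := match n with
    | 0 => inr (fun _ => A)
    | S n => match a n with
             | inl 0 => inl 0
             | inl (S _) => inl 1
             | inr c => inr (fun i => val (c i))
             end
    end : @symbol unit (fun _ => M)).
  apply (definable_iff (Ms := fun _ => M) (fun i e =>
    e 0 ∈ A /\ e 1 ∈ A /\ holds (relativize 0 S p) (fun n => interpret (b n) i e))).
  - intros i e.
    assert (Hb : forall x y : substructure A, e 0 = val x -> e 1 = val y ->
      (holds (relativize 0 S p) (fun n => interpret (b n) i e) <-> Q x y)).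
    { intros x y Hx Hy. rewrite <- (Hp i (scons x (fun _ => y))).
      apply holds_relativize; [reflexivity|]. intros n; simpl.
      destruct (a n) as [[|m]|c]; simpl; auto. }
    split.
    + intros (Hx & Hy & Hp'). exists (element _ Hx), (element _ Hy).
      split; [reflexivity|split; [reflexivity|]].
      exact (proj1 (Hb (element _ Hx) (element _ Hy) eq_refl eq_refl) Hp').
    + intros (x & y & Hx & Hy & HQ). rewrite (Hb x y Hx Hy), Hx, Hy.
      split; [apply val_mem|split; [apply val_mem|exact HQ]].
  - apply definable_and, definable_and; [definability..|].
    exists (relativize 0 S p), b. reflexivity.
Qed.

Definition defines_in {M : structure} (p : formula) (A f : M) : Prop :=
  forall e : nat -> substructure A, holds p e <-> rel f (val (e 0)) (val (e 1)).

Fixpoint var_bound (p : formula) : nat :=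
  match p with
  | Fmem i j | Feq i j => S (Nat.max i j)
  | Fneg p => var_bound p
  | Fand p q => Nat.max (var_bound p) (var_bound q)
  | Fex p => pred (var_bound p)
  end.

Section StandardFormulas.
Context {M : structure} {HM : Zermelo M} {HR : Ranked M}.
Implicit Types a c d f g h k i j o q s t v w x y z A B C D F T : M.

(** [u n] is the possibly nonstandard variable which stands for the [n]-th variable of
    [p].  The code is the same for all structures [A]. *)
Definition codes (p : formula) (u : nat -> M) c : Prop :=
  c ∈ formulas false /\
  forall A T s (e : nat -> substructure A),
    tarski A None T -> assignment A s ->
    (forall n, n < var_bound p -> rel s (u n) (val (e n))) ->
    (rel T c s <-> holds p e).

Lemma atom_holds_iff A (R : option M) (n : nat) i j s x y :
  assignment A s -> rel s i x -> rel s j y ->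
  (atom_holds R n i j s <-> atomic_relation R n x y).
Proof.
  intros Hs Hx Hy. split; [|intros Hxy; exists x, y; auto].
  intros (x' & y' & Hx' & Hy' & Hxy).
  rewrite (total_function_functional _ _ _ _ _ _ Hs Hx Hx'),
    (total_function_functional _ _ _ _ _ _ Hs Hy Hy').
  exact Hxy.
Qed.

Lemma codes_ex (p : formula) (u : nat -> M) k c :
  k ∈ omega -> (forall n, n < var_bound (Fex p) -> u n <> k) ->
  codes p (scons k u) c -> codes (Fex p) u (mk_ex k c).
Proof.
  intros Hk k_fresh [Hc c_codes].
  split; [exact (closed_ex _ _ _ (formulas_closed _) k c Hk Hc)|].
  intros A T s e HT Hs He. rewrite (tarski_ex _ _ _ HT s k c Hs Hk Hc).
  assert (He' : forall s' (x : substructure A), agree_off k s s' -> rel s' k (val x) ->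
    forall n, n < var_bound p -> rel s' (scons k u n) (val (scons x e n))).
  { intros s' x Hagree Hx [|n] Hn; simpl; [exact Hx|].
    apply Hagree; [apply k_fresh; simpl; lia|apply He; simpl; lia]. }
  split.
  - intros (s' & Hs' & Hagree & Hcs'). destruct (proj2 Hs' k Hk) as [x Hx].
    destruct (val_surj x (proj2 (total_function_rel _ _ _ _ _ Hs' Hx))) as [x' <-].
    exists x'. apply (c_codes A T s' (scons x' e) HT Hs'); [|exact Hcs'].
    exact (He' s' x' Hagree Hx).
  - intros [x Hx].
    destruct (update_exists s omega A k (val x) Hs Hk (val_mem x))
      as (s' & Hs' & Hkx & Hagree).
    exists s'. split; [exact Hs'|split; [exact Hagree|]].
    apply (c_codes A T s' (scons x e) HT Hs'); [|exact Hx].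
    exact (He' s' x Hagree Hkx).
Qed.

Lemma codes_exists (p : formula) :
  forall u : nat -> M, (forall n, u n ∈ omega) -> exists c, codes p u c.
Proof.
  destruct (formulas_closed false) as [F_atom F_neg F_and _].
  induction p as [i j|i j|p IH|p IHp q IHq|p IH]; intros u Hu.
  - exists (mk_atom 0 (u i) (u j)). split; [apply F_atom; simpl; auto|].
    intros A T s e HT Hs He. rewrite (tarski_atom _ _ _ HT) by (simpl; auto).
    apply (atom_holds_iff A None 0); [exact Hs|apply He; simpl; lia..].
  - exists (mk_atom 1 (u i) (u j)). split; [apply F_atom; simpl; auto|].
    intros A T s e HT Hs He. rewrite (tarski_atom _ _ _ HT) by (simpl; auto).
    rewrite (atom_holds_iff A None 1 _ _ s (val (e i)) (val (e j)) Hs)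
      by (apply He; simpl; lia).
    split; [apply val_inj|simpl; congruence].
  - destruct (IH u Hu) as (c & Hc & c_codes).
    exists (mk_neg c). split; [exact (F_neg c Hc)|].
    intros A T s e HT Hs He. rewrite (tarski_neg _ _ _ HT s c Hs Hc), (c_codes A T s e) by auto.
    reflexivity.
  - destruct (IHp u Hu) as (c & Hc & c_codes), (IHq u Hu) as (d & Hd & d_codes).
    exists (mk_and c d). split; [exact (F_and c d Hc Hd)|].
    intros A T s e HT Hs He. simpl in He. rewrite (tarski_and _ _ _ HT s c d Hs Hc Hd).
    rewrite (c_codes A T s e HT Hs), (d_codes A T s e HT Hs); [reflexivity|..];
      intros n Hn; apply He; lia.
  - destruct (omega_finitely_bounded u (var_bound (Fex p)) Hu) as (k & Hk & k_bound).
    destruct (IH (scons k u)) as [c c_codes]; [intros [|n]; simpl; auto|].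
    exists (mk_ex k c). apply codes_ex; [exact Hk| |exact c_codes].
    intros n Hn Heq. apply (mem_irrefl k). rewrite <- Heq at 1. auto.
Qed.

Lemma binary_code_exists (p : formula) i j :
  i ∈ omega -> j ∈ omega ->
  exists c, c ∈ formulas false /\
    forall A T f s x y, tarski A None T -> defines_in p A f -> assignment A s ->
      rel s i x -> rel s j y -> (rel T c s <-> rel f x y).
Proof.
  intros Hi Hj.
  destruct (codes_exists p (scons i (fun _ => j))) as (c & Hc & c_codes);
    [intros [|n]; assumption|].
  exists c. split; [exact Hc|]. intros A T f s x y HT Hf Hs Hx Hy.
  destruct (val_surj x (proj2 (total_function_rel _ _ _ _ _ Hs Hx))) as [x' <-].
  destruct (val_surj y (proj2 (total_function_rel _ _ _ _ _ Hs Hy))) as [y' <-].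
  rewrite (c_codes A T s (scons x' (fun _ => y')) HT Hs); [apply Hf|].
  intros [|n] _; assumption.
Qed.

Lemma defines_in_definable_in (p : formula) A f : defines_in p A f -> definable_in A f.
Proof.
  intros Hf.
  destruct (binary_code_exists p (numeral 0) (numeral 1)) as (c & Hc & c_codes);
    [apply numeral_mem_omega..|].
  exists omega, (formulas false), c. split; [exact is_omega_omega|].
  split; [apply is_formulas_formulas|split; [exact Hc|]].
  intros s i0 i1 x y Hs Hi0 Hi1 Hx Hy. apply is_num_iff in Hi0, Hi1; subst.
  destruct (tarski_exists A None) as [T HT].
  rewrite (satisfies_iff A None T c s HT Hc Hs).
  exact (c_codes A T f s x y HT Hf Hs Hx Hy).
Qed.

Lemma assignment_exists A (e : nat -> substructure A) (N : nat) :
  exists s, assignment A s /\ forall n, n < N -> rel s (numeral n) (val (e n)).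
Proof.
  induction N as [|N (s & Hs & IH)].
  - destruct (constant_function_exists omega A (val (e 0)) (val_mem _)) as (s & Hs & _).
    exists s. split; [exact Hs|lia].
  - destruct (update_exists s omega A (numeral N) (val (e N)) Hs (numeral_mem_omega N)
      (val_mem _)) as (s' & Hs' & HN & Hagree).
    exists s'. split; [exact Hs'|]. intros n Hn.
    destruct (Nat.eq_dec n N) as [->|Hne]; [exact HN|].
    apply Hagree; [intros Heq; apply Hne, numeral_inj, Heq|apply IH; lia].
Qed.

Lemma elementary_holds (p : formula) A B
    (e : nat -> substructure A) (e' : nat -> substructure B) :
  elementary A None B None -> (forall n, val (e n) = val (e' n)) ->
  (holds p e <-> holds p e').
Proof.
  intros [A_sub Hsat]%elementary_iff He; [|reflexivity].
  destruct (codes_exists p numeral numeral_mem_omega) as (c & Hc & c_codes).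
  destruct (assignment_exists A e (var_bound p)) as (s & Hs & Hse).
  assert (HsB := total_function_widen _ _ _ _ A_sub Hs).
  destruct (tarski_exists A None) as [T HT], (tarski_exists B None) as [T' HT'].
  rewrite <- (c_codes A T s e HT Hs Hse), <- (c_codes B T' s e' HT' HsB).
  - rewrite <- (satisfies_iff A None T c s HT Hc Hs),
      <- (satisfies_iff B None T' c s HT' Hc HsB).
    exact (Hsat c s Hc Hs).
  - intros n Hn. rewrite <- He. exact (Hse n Hn).
Qed.

Lemma elementary_uniformly_definable A B (Q : forall N : structure, (nat -> N) -> Prop)
    (e : nat -> substructure A) (e' : nat -> substructure B) :
  uniformly_definable Q -> elementary A None B None ->
  (forall n, val (e n) = val (e' n)) -> (Q (substructure A) e <-> Q (substructure B) e').
Proof.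
  intros Q_def AB He. destruct (uniformly_definable_formula Q Q_def) as [p Hp].
  rewrite <- !Hp. exact (elementary_holds p A B e e' AB He).
Qed.

(* The translation replaces the atoms for the function by codes of [p].  Two structures
   are considered at once because both need the same translation. *)
Lemma function_symbol_eliminable (p : formula) A B f g S T S' T' :
  defines_in p A f -> defines_in p B g ->
  tarski A (Some f) S -> tarski A None T -> tarski B (Some g) S' -> tarski B None T' ->
  forall c, c ∈ formulas true ->
  exists c', c' ∈ formulas false /\ same_truth A S T c c' /\ same_truth B S' T' c c'.
Proof.
  intros Hf Hg HS HT HS' HT'. destruct (formulas_closed false) as [F_atom F_neg F_and F_ex].
  apply formula_ind.
  - unfold same_truth, assignment. definability.
  - intros n i j Hn Hi Hj. simpl in Hn.
    assert (Hkind : n < 2 \/ n = 2) by lia. destruct Hkind as [Hn2| ->].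
    + exists (mk_atom n i j). split; [apply F_atom; assumption|].
      split; [apply (same_truth_atom A (Some f) None)|apply (same_truth_atom B (Some g) None)];
        auto; destruct n as [|[|n]]; simpl; reflexivity || lia.
    + destruct (binary_code_exists p i j Hi Hj) as (c & Hc & c_codes).
      exists c. split; [exact Hc|]. split; intros s Hs;
        destruct (proj2 Hs i Hi) as [x Hx], (proj2 Hs j Hj) as [y Hy].
      * rewrite (c_codes A T f s x y HT Hf Hs Hx Hy), (tarski_atom _ _ _ HS) by auto.
        exact (atom_holds_iff A (Some f) 2 i j s x y Hs Hx Hy).
      * rewrite (c_codes B T' g s x y HT' Hg Hs Hx Hy), (tarski_atom _ _ _ HS') by auto.
        exact (atom_holds_iff B (Some g) 2 i j s x y Hs Hx Hy).
  - intros q Hq (q' & Hq' & HA & HB). exists (mk_neg q'). split; [exact (F_neg q' Hq')|].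
    split; eapply same_truth_neg; eassumption.
  - intros q r Hq Hr (q' & Hq' & HA & HB) (r' & Hr' & HA' & HB').
    exists (mk_and q' r'). split; [exact (F_and q' r' Hq' Hr')|].
    split; eapply same_truth_and; eassumption.
  - intros i q Hi Hq (q' & Hq' & HA & HB).
    exists (mk_ex i q'). split; [exact (F_ex i q' Hi Hq')|].
    split; eapply same_truth_ex; eassumption.
Qed.

Lemma elementary_definable_expansion (p : formula) A B f g :
  elementary A None B None -> defines_in p A f -> defines_in p B g ->
  elementary A (Some f) B (Some g).
Proof.
  intros [A_sub Hsat]%elementary_iff Hf Hg; [|reflexivity].
  apply elementary_iff; [reflexivity|]. split; [exact A_sub|]. intros c s Hc Hs.
  destruct (tarski_exists A None) as [T HT], (tarski_exists B None) as [T' HT'].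
  destruct (tarski_exists A (Some f)) as [S HS], (tarski_exists B (Some g)) as [S' HS'].
  destruct (function_symbol_eliminable p A B f g S T S' T' Hf Hg HS HT HS' HT' c Hc)
    as (c' & Hc' & HA & HB).
  assert (HsB : assignment B s) by exact (total_function_widen _ _ _ _ A_sub Hs).
  rewrite (satisfies_iff A (Some f) S c s HS Hc Hs), (HA s Hs),
    <- (satisfies_iff A None T c' s HT Hc' Hs).
  rewrite (satisfies_iff B (Some g) S' c s HS' Hc HsB), (HB s HsB),
    <- (satisfies_iff B None T' c' s HT' Hc' HsB).
  exact (Hsat c' s Hc' Hs).
Qed.

End StandardFormulas.

(** * Absoluteness for limit stages of the hierarchy *)

Section LimitStageModel.
Context {M : structure} {HM : Zermelo M} {HR : Ranked M} {l U : M}.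
Context (l_limit : limit_ordinal l) (omega_lt_l : omega ∈ l) (HU : is_V l U).
Implicit Types a b c d f g h i j k p q r s t u v w x y z A B C F T : substructure U.

Lemma val_mem_surj x (z : M) : z ∈ val x -> exists z', val z' = z.
Proof. intros Hz. apply val_surj. exact (V_transitive l U HU (val x) (val_mem x) z Hz). Qed.

Lemma omega_mem_stage : omega ∈ U.
Proof. exact (ordinal_subset_V l U HU omega omega_lt_l). Qed.

Lemma substructure_extensionality x y : (forall z, z ∈ x <-> z ∈ y) -> x = y.
Proof.
  intros Hxy. apply val_inj, extensionality. intros z. split; intros Hz.
  - destruct (val_mem_surj x z Hz) as [z' <-]. apply (Hxy z'), Hz.
  - destruct (val_mem_surj y z Hz) as [z' <-]. apply (Hxy z'), Hz.
Qed.

Lemma substructure_infinity : exists w : substructure U, inductive_set w.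
Proof.
  destruct (val_surj omega omega_mem_stage) as [w Hw]. exists w.
  assert (mem_w : forall x, x ∈ w <-> val x ∈ omega) by (rewrite <- Hw; reflexivity).
  split.
  - destruct (val_mem_surj w empty_set) as [o Ho]; [rewrite Hw; exact empty_set_mem_omega|].
    exists o. split; [|apply mem_w; rewrite Ho; exact empty_set_mem_omega].
    intros z Hz. apply (mem_empty_set (val z)). rewrite <- Ho. exact Hz.
  - intros x Hx%mem_w.
    destruct (val_mem_surj w (successor (val x))) as [y Hy].
    { rewrite Hw. exact (successor_mem_omega _ Hx). }
    exists y. split; [|apply mem_w; rewrite Hy; exact (successor_mem_omega _ Hx)].
    intros z. change (val z ∈ val y <-> z ∈ x \/ z = x). rewrite Hy, mem_successor.
    split; (intros [Hz|Hz]; [left; exact Hz|right]); [apply val_inj, Hz|congruence].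
Qed.

Lemma substructure_separation (p : formula) (e : nat -> substructure U) a :
  exists b, forall x, x ∈ b <-> x ∈ a /\ holds p (scons x e).
Proof.
  assert (Q_def : definable_relation (fun x _ : substructure U => holds p (scons x e))).
  { exists p, (fun n => match n with 0 => inl 0 | S n => inr (fun _ => e n) end).
    intros i e'. apply holds_ext. intros [|n]; reflexivity. }
  apply definable_relation_substructure in Q_def.
  destruct (separation (fun x : M => exists x' y', x = val x' /\ x = val y' /\
    holds p (scons x' e)) (val a)) as [b Hb].
  { exact (definable_subst (Ms := fun _ => M) _ (fun _ _ e => e 0) Q_def
      (fun _ => is_symbol_variable 0)). }
  destruct (val_surj (A := U) b) as [b' Hb'].
  { apply (V_subset_closed l U (val a) b HU (val_mem a)). intros x Hx. apply Hb, Hx. }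
  exists b'. intros x. change (val x ∈ val b' <-> val x ∈ val a /\ holds p (scons x e)).
  rewrite Hb', Hb. split; intros [Hx Hp]; (split; [exact Hx|]).
  - destruct Hp as (x' & _ & Heq & _ & Hp). rewrite (val_inj _ _ Heq). exact Hp.
  - exists x, x. auto.
Qed.

#[local] Instance substructure_Zermelo : Zermelo (substructure U).
Proof.
  split.
  - exact substructure_extensionality.
  - intros x [y Hy].
    destruct (foundation (val x)) as (z & Hz & z_min); [exists (val y); exact Hy|].
    destruct (val_mem_surj x z Hz) as [z' <-]. exists z'.
    split; [exact Hz|intros u; apply (z_min (val u))].
  - intros x y.
    destruct (val_surj _ (limit_V_unordered_pair l U l_limit HU _ _ (val_mem x) (val_mem y)))
      as [p Hp].
    exists p. intros z. change (val z ∈ val p <-> z = x \/ z = y).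
    rewrite Hp, mem_unordered_pair. split; intros [Hz|Hz]; subst; auto;
      apply val_inj in Hz; auto.
  - intros x. destruct (val_surj _ (V_union_set l U _ HU (val_mem x))) as [u Hu].
    exists u. intros z. change (val z ∈ val u <-> exists y, y ∈ x /\ z ∈ y).
    rewrite Hu, mem_union_set. split.
    + intros (y & Hy & Hz). destruct (val_mem_surj x y Hy) as [y' <-]. exists y'; auto.
    + intros (y & Hy & Hz). exists (val y); auto.
  - intros x. destruct (val_surj _ (limit_V_power_set l U l_limit HU _ (val_mem x))) as [p Hp].
    exists p. intros z. change (val z ∈ val p <-> subset z x).
    rewrite Hp, mem_power_set. split.
    + intros Hz y. apply (Hz (val y)).
    + intros Hz y Hy. destruct (val_mem_surj z y Hy) as [y' <-]. exact (Hz y' Hy).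
  - exact substructure_infinity.
  - exact substructure_separation.
Qed.

(** ** Set operations *)

Lemma subset_absolute x y : subset x y <-> subset (val x) (val y).
Proof.
  split.
  - intros Hxy z Hz. destruct (val_mem_surj x z Hz) as [z' <-]. exact (Hxy z' Hz).
  - intros Hxy z. exact (Hxy (val z)).
Qed.

Lemma val_eq x (y : M) : y ∈ U -> (forall z, z ∈ x <-> val z ∈ y) -> val x = y.
Proof.
  intros Hy Hxy. destruct (val_surj y Hy) as [y' <-]. f_equal.
  apply extensionality, Hxy.
Qed.

Lemma eq_absolute x y : x = y <-> val x = val y.
Proof. split; [congruence|apply val_inj]. Qed.

Lemma val_empty_set : val empty_set = empty_set.
Proof.
  apply val_eq; [exact (V_transitive l U HU omega omega_mem_stage _ empty_set_mem_omega)|].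
  intros z. split; intros Hz; destruct (mem_empty_set _ Hz).
Qed.

Lemma is_empty_absolute x : is_empty x <-> is_empty (val x).
Proof. rewrite !is_empty_iff, <- val_empty_set. apply eq_absolute. Qed.

Lemma val_unordered_pair x y : val (unordered_pair x y) = unordered_pair (val x) (val y).
Proof.
  apply val_eq; [exact (limit_V_unordered_pair l U l_limit HU _ _ (val_mem x) (val_mem y))|].
  intros z. rewrite !mem_unordered_pair, !eq_absolute. reflexivity.
Qed.

Lemma val_ordered_pair x y : val (ordered_pair x y) = ordered_pair (val x) (val y).
Proof. unfold ordered_pair. rewrite !val_unordered_pair. reflexivity. Qed.

Lemma val_successor x : val (successor x) = successor (val x).
Proof.
  apply val_eq; [exact (limit_V_successor l U l_limit HU _ (val_mem x))|].
  intros z. rewrite !mem_successor, eq_absolute. reflexivity.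
Qed.

Lemma val_power_set x : val (power_set x) = power_set (val x).
Proof.
  apply val_eq; [exact (limit_V_power_set l U l_limit HU _ (val_mem x))|].
  intros z. rewrite !mem_power_set. apply subset_absolute.
Qed.

Lemma inductive_set_absolute w : inductive_set w <-> inductive_set (val w).
Proof.
  rewrite !inductive_set_iff, <- val_empty_set. split; intros [w_empty w_succ];
    (split; [exact w_empty|]); intros x Hx.
  - destruct (val_mem_surj w x Hx) as [x' <-]. rewrite <- val_successor. exact (w_succ x' Hx).
  - change (val (successor x) ∈ val w). rewrite val_successor. exact (w_succ (val x) Hx).
Qed.

Lemma val_omega : val omega = omega.
Proof.
  apply subset_antisym.
  - destruct (val_surj omega omega_mem_stage) as [o Ho]. rewrite <- Ho.
    apply subset_absolute, (proj2 is_omega_omega), inductive_set_absolute.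
    rewrite Ho. apply is_omega_omega.
  - apply (proj2 is_omega_omega), inductive_set_absolute, is_omega_omega.
Qed.

Lemma val_numeral (n : nat) : val (numeral n) = numeral n.
Proof.
  induction n as [|n IH]; simpl; [exact val_empty_set|rewrite val_successor, IH; reflexivity].
Qed.

(** ** Functions and cardinals *)

Lemma rel_absolute r x y : rel r x y <-> rel (val r) (val x) (val y).
Proof. rewrite !rel_iff, <- val_ordered_pair. reflexivity. Qed.

Lemma rel_val_surj r (x y : M) :
  rel (val r) x y -> exists x' y', val x' = x /\ val y' = y /\ rel r x' y'.
Proof.
  intros Hxy. assert (Hpair := proj1 (rel_iff _ _ _) Hxy).
  apply (V_transitive l U HU _ (val_mem r)), (limit_V_ordered_pair l U l_limit HU) in Hpair
    as [Hx Hy].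
  exists (element x Hx), (element y Hy).
  split; [reflexivity|split; [reflexivity|apply rel_absolute, Hxy]].
Qed.

Lemma ordinal_absolute x : ordinal x <-> ordinal (val x).
Proof.
  split; intros [x_trans x_linear]; split.
  - intros y Hy. destruct (val_mem_surj x y Hy) as [y' <-]. apply subset_absolute, x_trans, Hy.
  - intros y z Hy Hz. destruct (val_mem_surj x y Hy) as [y' <-].
    destruct (val_mem_surj x z Hz) as [z' <-]. rewrite <- eq_absolute.
    exact (x_linear y' z' Hy Hz).
  - intros y Hy. apply subset_absolute, x_trans, Hy.
  - intros y z Hy Hz. rewrite eq_absolute. exact (x_linear _ _ Hy Hz).
Qed.

Lemma total_function_absolute f A B :
  total_function f A B <-> total_function (val f) (val A) (val B).
Proof.
  split; intros [[f_pairs f_functional] f_total]; split; [split| |split|].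
  - intros p Hp. destruct (val_mem_surj f p Hp) as [p' <-].
    destruct (f_pairs p' Hp) as (a & b & Ha & Hb & Heq). exists (val a), (val b).
    split; [exact Ha|split; [exact Hb|]].
    apply is_opair_iff in Heq. rewrite Heq, val_ordered_pair. apply is_opair_iff. reflexivity.
  - intros a b b' Hb Hb'.
    destruct (rel_val_surj f a b Hb) as (x & y & <- & <- & Hxy).
    destruct (rel_val_surj f _ b' Hb') as (x' & y' & Heq & <- & Hxy').
    apply val_inj in Heq; subst. f_equal. exact (f_functional x y y' Hxy Hxy').
  - intros a Ha. destruct (val_mem_surj A a Ha) as [a' <-].
    destruct (f_total a' Ha) as [b Hb]. exists (val b). apply rel_absolute, Hb.
  - intros p Hp. destruct (f_pairs (val p) Hp) as (a & b & Ha & Hb & Heq).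
    destruct (val_mem_surj A a Ha) as [a' <-], (val_mem_surj B b Hb) as [b' <-].
    exists a', b'. split; [exact Ha|split; [exact Hb|]].
    apply is_opair_iff. apply is_opair_iff in Heq. apply val_inj.
    rewrite val_ordered_pair. exact Heq.
  - intros a b b' Hb Hb'. apply val_inj.
    apply (f_functional (val a)); apply rel_absolute; assumption.
  - intros a Ha. destruct (f_total (val a) Ha) as [b Hb].
    destruct (rel_val_surj f _ b Hb) as (x & b' & Heq & <- & Hrel).
    apply val_inj in Heq; subst. exists b'. exact Hrel.
Qed.

Lemma total_function_val_surj (f : M) A B :
  total_function f (val A) (val B) -> exists f', val f' = f /\ total_function f' A B.
Proof.
  intros Hf. destruct (val_surj (A := U) f) as [f' <-].
  - exact (limit_V_partial_function l U l_limit HU f _ _ (val_mem A) (val_mem B) (proj1 Hf)).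
  - exists f'. split; [reflexivity|apply total_function_absolute, Hf].
Qed.

Lemma equinumerous_absolute A B : equinumerous A B <-> equinumerous (val A) (val B).
Proof.
  split.
  - intros (f & f_total & f_inj & f_surj). exists (val f).
    split; [apply total_function_absolute, f_total|split].
    + intros a a' b Ha Ha'.
      destruct (rel_val_surj f a b Ha) as (x & y & <- & <- & Hxy).
      destruct (rel_val_surj f a' _ Ha') as (x' & y' & <- & Heq & Hxy').
      apply val_inj in Heq; subst. f_equal. exact (f_inj x x' y Hxy Hxy').
    + intros b Hb. destruct (val_mem_surj B b Hb) as [b' <-].
      destruct (f_surj b' Hb) as [a Ha]. exists (val a). apply rel_absolute, Ha.
  - intros (f & f_total & f_inj & f_surj).
    destruct (total_function_val_surj f A B f_total) as (f' & <- & f'_total).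
    exists f'. split; [exact f'_total|split].
    + intros a a' b Ha Ha'. apply val_inj.
      apply (f_inj _ _ (val b)); apply rel_absolute; assumption.
    + intros b Hb. destruct (f_surj (val b) Hb) as [a Ha].
      destruct (rel_val_surj f' a _ Ha) as (a' & b' & _ & Heq & Hrel).
      apply val_inj in Heq; subst. exists a'. exact Hrel.
Qed.

Lemma cardinal_absolute k : cardinal k <-> cardinal (val k).
Proof.
  unfold cardinal. rewrite ordinal_absolute.
  split; intros [k_ordinal k_initial]; (split; [exact k_ordinal|]); intros a Ha.
  - destruct (val_mem_surj k a Ha) as [a' <-].
    rewrite <- equinumerous_absolute. exact (k_initial a' Ha).
  - rewrite equinumerous_absolute. exact (k_initial _ Ha).
Qed.

Lemma regular_absolute k : regular k <-> regular (val k).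
Proof.
  split.
  - intros k_regular a g Ha Hg. destruct (val_mem_surj k a Ha) as [a' <-].
    destruct (total_function_val_surj g a' k Hg) as (g' & <- & Hg').
    destruct (k_regular a' g' Ha Hg') as (b & Hb & b_bound).
    exists (val b). split; [exact Hb|]. intros x y Hxy.
    destruct (rel_val_surj g' x y Hxy) as (x' & y' & <- & <- & Hxy').
    exact (b_bound x' y' Hxy').
  - intros k_regular a g Ha Hg%total_function_absolute.
    destruct (k_regular (val a) (val g) Ha Hg) as (b & Hb & b_bound).
    destruct (val_mem_surj k b Hb) as [b' <-]. exists b'. split; [exact Hb|].
    intros x y Hxy%rel_absolute. exact (b_bound _ _ Hxy).
Qed.

Lemma strong_limit_absolute k : strong_limit k <-> strong_limit (val k).
Proof.
  unfold strong_limit. setoid_rewrite is_power_iff.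
  split; intros k_strong a Ha.
  - destruct (val_mem_surj k a Ha) as [a' <-].
    destruct (k_strong a' Ha) as (p & b & -> & Hb & Hpb). exists (val (power_set a')), (val b).
    split; [apply val_power_set|split; [exact Hb|apply equinumerous_absolute, Hpb]].
  - destruct (k_strong (val a) Ha) as (p & b & -> & Hb & Hpb).
    destruct (val_mem_surj k b Hb) as [b' <-]. exists (power_set a), b'.
    split; [reflexivity|split; [exact Hb|]].
    apply equinumerous_absolute. rewrite val_power_set. exact Hpb.
Qed.

Lemma inaccessible_absolute k : inaccessible k <-> inaccessible (val k).
Proof.
  unfold inaccessible. rewrite !exists_omega_mem_iff, <- val_omega.
  rewrite cardinal_absolute, regular_absolute, strong_limit_absolute. reflexivity.
Qed.

(** ** The hierarchy *)

Lemma is_V_of_val a v : is_V (val a) (val v) -> is_V a v.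
Proof.
  intros Hv. destruct (V_recursion_of_is_V _ _ Hv) as (h & h_total & h_rec & Hav).
  rewrite <- val_successor, <- val_power_set in h_total.
  destruct (total_function_val_surj h _ _ h_total) as (h' & <- & h'_total).
  apply is_V_iff. split; [apply ordinal_absolute, Hv|].
  exists h', (power_set v). split; [exact h'_total|split; [|apply rel_absolute, Hav]].
  intros b y Hy%rel_absolute z. change (val z ∈ val y <-> exists c x,
    c ∈ b /\ rel h' c x /\ subset z x).
  rewrite (h_rec _ _ Hy (val z)). split.
  - intros (c & x & Hc & Hx & Hz).
    destruct (rel_val_surj h' c x Hx) as (c' & x' & <- & <- & Hx').
    exists c', x'. split; [exact Hc|split; [exact Hx'|apply subset_absolute, Hz]].
  - intros (c & x & Hc & Hx & Hz). exists (val c), (val x).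
    split; [exact Hc|split; [apply rel_absolute, Hx|apply subset_absolute, Hz]].
Qed.

Lemma is_V_val_exists a : ordinal a -> exists v, is_V (val a) (val v).
Proof.
  intros Ha%ordinal_absolute.
  assert (Hal := proj1 (ordinal_mem_V l U (val a) HU Ha) (val_mem a)).
  destruct (V_exists (val a) Ha) as [v Hv].
  destruct (val_surj v (V_mem_V l U (val a) v HU Hv Hal)) as [v' <-]. exists v'; exact Hv.
Qed.

#[local] Instance substructure_Ranked : Ranked (substructure U).
Proof.
  intros a Ha. destruct (is_V_val_exists a Ha) as [v Hv]. exists v. exact (is_V_of_val a v Hv).
Qed.

Lemma is_V_absolute a v : is_V a v <-> is_V (val a) (val v).
Proof.
  split; [|apply is_V_of_val]. intros Hv.
  destruct (is_V_val_exists a (is_V_ordinal a v Hv)) as [v' Hv'].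
  rewrite (is_V_unique a v v' Hv (is_V_of_val a v' Hv')). exact Hv'.
Qed.

(** ** Formulas and truth *)

Lemma val_mk_atom (n : nat) i j : val (mk_atom n i j) = mk_atom n (val i) (val j).
Proof. unfold mk_atom. rewrite !val_ordered_pair, val_numeral. reflexivity. Qed.

Lemma val_mk_neg p : val (mk_neg p) = mk_neg (val p).
Proof. unfold mk_neg. rewrite val_ordered_pair, val_numeral. reflexivity. Qed.

Lemma val_mk_and p q : val (mk_and p q) = mk_and (val p) (val q).
Proof. unfold mk_and. rewrite !val_ordered_pair, val_numeral. reflexivity. Qed.

Lemma val_mk_ex i p : val (mk_ex i p) = mk_ex (val i) (val p).
Proof. unfold mk_ex. rewrite !val_ordered_pair, val_numeral. reflexivity. Qed.

Lemma closed_under_constructors_absolute (b : bool) w C :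
  closed_under_constructors b w C <-> closed_under_constructors b (val w) (val C).
Proof.
  split; intros [C_atom C_neg C_and C_ex]; split.
  - intros n i j Hn Hi Hj.
    destruct (val_mem_surj w i Hi) as [i' <-], (val_mem_surj w j Hj) as [j' <-].
    rewrite <- val_mk_atom. exact (C_atom n i' j' Hn Hi Hj).
  - intros p Hp. destruct (val_mem_surj C p Hp) as [p' <-].
    rewrite <- val_mk_neg. exact (C_neg p' Hp).
  - intros p q Hp Hq.
    destruct (val_mem_surj C p Hp) as [p' <-], (val_mem_surj C q Hq) as [q' <-].
    rewrite <- val_mk_and. exact (C_and p' q' Hp Hq).
  - intros i p Hi Hp.
    destruct (val_mem_surj w i Hi) as [i' <-], (val_mem_surj C p Hp) as [p' <-].
    rewrite <- val_mk_ex. exact (C_ex i' p' Hi Hp).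
  - intros n i j Hn Hi Hj. change (val (mk_atom n i j) ∈ val C).
    rewrite val_mk_atom. exact (C_atom n _ _ Hn Hi Hj).
  - intros p Hp. change (val (mk_neg p) ∈ val C). rewrite val_mk_neg. exact (C_neg _ Hp).
  - intros p q Hp Hq. change (val (mk_and p q) ∈ val C).
    rewrite val_mk_and. exact (C_and _ _ Hp Hq).
  - intros i p Hi Hp. change (val (mk_ex i p) ∈ val C).
    rewrite val_mk_ex. exact (C_ex _ _ Hi Hp).
Qed.

Lemma formulas_mem_stage (b : bool) : formulas b ∈ U.
Proof.
  destruct (V_exists (omega : M) ordinal_omega) as [v Hv].
  apply (V_subset_closed l U v _ HU (V_mem_V l U omega v HU Hv omega_lt_l)).
  apply formulas_least, formula_closed_iff.
  apply (formula_closed_V b omega v limit_ordinal_omega Hv).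
  exact (ordinal_subset_V omega v Hv).
Qed.

Lemma val_formulas (b : bool) : val (formulas b) = formulas b.
Proof.
  apply subset_antisym.
  - destruct (val_surj _ (formulas_mem_stage b)) as [F HF]. rewrite <- HF.
    apply subset_absolute, formulas_least, closed_under_constructors_absolute.
    rewrite HF, val_omega. apply formulas_closed.
  - apply formulas_least. rewrite <- val_omega.
    apply closed_under_constructors_absolute, formulas_closed.
Qed.

Lemma assignment_absolute A s : assignment A s <-> assignment (val A) (val s).
Proof. unfold assignment. rewrite total_function_absolute, val_omega. reflexivity. Qed.

Lemma assignment_val_surj A (s : M) :
  assignment (val A) s -> exists s', val s' = s /\ assignment A s'.
Proof. unfold assignment. rewrite <- val_omega. apply total_function_val_surj. Qed.

Lemma agree_off_absolute i s s' :
  agree_off i s s' <-> agree_off (val i) (val s) (val s').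
Proof.
  unfold agree_off. split; intros Hagree j x Hj.
  - split; intros Hx;
      [destruct (rel_val_surj s' j x Hx) as (j' & x' & <- & <- & _)
      |destruct (rel_val_surj s j x Hx) as (j' & x' & <- & <- & _)];
      apply rel_absolute, Hagree; [congruence|apply rel_absolute, Hx
      |congruence|apply rel_absolute, Hx].
  - rewrite !rel_absolute. apply Hagree. rewrite <- eq_absolute. exact Hj.
Qed.

Lemma atom_holds_absolute (n : nat) i j s :
  n < 2 -> atom_holds None n i j s <-> atom_holds None n (val i) (val j) (val s).
Proof.
  intros Hn.
  assert (atomic_absolute : forall x y,
    atomic_relation None n x y <-> atomic_relation None n (val x) (val y)).
  { destruct n as [|[|n]]; [reflexivity|exact eq_absolute|lia]. }
  split.
  - intros (x & y & Hx & Hy & Hxy). exists (val x), (val y).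
    rewrite <- !rel_absolute, <- atomic_absolute. auto.
  - intros (x & y & Hx & Hy & Hxy).
    destruct (rel_val_surj s _ x Hx) as (i' & x' & Hi & <- & Hx').
    destruct (rel_val_surj s _ y Hy) as (j' & y' & Hj & <- & Hy').
    apply val_inj in Hi, Hj; subst. exists x', y'. rewrite atomic_absolute. auto.
Qed.

Lemma tarski_val A T : tarski A None T -> tarski (val A) None (val T).
Proof.
  intros HT. split; intros s.
  - intros n i j (s' & <- & Hs)%assignment_val_surj Hn Hi Hj. rewrite <- val_omega in Hi, Hj.
    destruct (val_mem_surj _ i Hi) as [i' <-], (val_mem_surj _ j Hj) as [j' <-].
    rewrite <- val_mk_atom, <- rel_absolute, <- atom_holds_absolute by exact Hn.
    exact (tarski_atom _ _ _ HT s' n i' j' Hs Hn Hi Hj).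
  - simpl has_fun. rewrite <- val_formulas.
    intros p (s' & <- & Hs)%assignment_val_surj Hp. destruct (val_mem_surj _ p Hp) as [p' <-].
    rewrite <- val_mk_neg, <- !rel_absolute. exact (tarski_neg _ _ _ HT s' p' Hs Hp).
  - simpl has_fun. rewrite <- val_formulas.
    intros p q (s' & <- & Hs)%assignment_val_surj Hp Hq.
    destruct (val_mem_surj _ p Hp) as [p' <-], (val_mem_surj _ q Hq) as [q' <-].
    rewrite <- val_mk_and, <- !rel_absolute. exact (tarski_and _ _ _ HT s' p' q' Hs Hp Hq).
  - simpl has_fun. rewrite <- val_formulas, <- val_omega.
    intros i p (s' & <- & Hs)%assignment_val_surj Hi Hp.
    destruct (val_mem_surj _ i Hi) as [i' <-], (val_mem_surj _ p Hp) as [p' <-].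
    rewrite <- val_mk_ex, <- rel_absolute, (tarski_ex _ _ _ HT s' i' p' Hs Hi Hp). split.
    + intros (u & Hu & Hagree & Hpu). exists (val u).
      rewrite <- assignment_absolute, <- agree_off_absolute, <- rel_absolute. auto.
    + intros (u & Hu & Hagree & Hpu). destruct (assignment_val_surj A u Hu) as (u' & <- & Hu').
      exists u'. rewrite agree_off_absolute, rel_absolute. auto.
Qed.

Lemma satisfies_absolute A c s :
  c ∈ formulas false -> assignment A s ->
  (satisfies A None c s <-> satisfies (val A) None (val c) (val s)).
Proof.
  intros Hc Hs. destruct (tarski_exists A None) as [T HT].
  rewrite (satisfies_iff A None T c s HT Hc Hs).
  rewrite (satisfies_iff (val A) None (val T) (val c) (val s) (tarski_val A T HT)).
  - apply rel_absolute.
  - simpl has_fun. rewrite <- val_formulas. exact Hc.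
  - apply assignment_absolute, Hs.
Qed.

Lemma elementary_absolute A B :
  elementary A None B None <-> elementary (val A) None (val B) None.
Proof.
  rewrite !elementary_iff by reflexivity. rewrite subset_absolute. simpl has_fun.
  split; intros [A_sub Hsat]; (split; [exact A_sub|]); intros c s Hc Hs.
  - rewrite <- val_formulas in Hc. destruct (val_mem_surj _ c Hc) as [c' <-].
    destruct (assignment_val_surj A s Hs) as (s' & <- & Hs').
    assert (HsB : assignment B s').
    { apply assignment_absolute. exact (total_function_widen _ _ _ _ A_sub Hs). }
    rewrite <- !satisfies_absolute by assumption. exact (Hsat c' s' Hc Hs').
  - assert (HsA := proj1 (assignment_absolute A s) Hs).
    assert (HsB : assignment B s).
    { apply assignment_absolute. exact (total_function_widen _ _ _ _ A_sub HsA). }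
    rewrite !satisfies_absolute by assumption. apply Hsat; [|exact HsA].
    rewrite <- val_formulas. exact Hc.
Qed.

End LimitStageModel.

(** * The Menas function *)

Definition target {M : structure} (b g : M) : Prop :=
  inaccessible g /\ exists Vb Vg : M,
    is_V b Vb /\ is_V g Vg /\ elementary Vb None Vg None.

Definition target_bound {M : structure} (b d : M) : Prop :=
  ordinal d /\ forall g : M, target b g -> g ∈ d.

Definition menas {M : structure} (b d : M) : Prop :=
  ordinal b /\
  ((target_bound b d /\ forall d' : M, d' ∈ d -> ~ target_bound b d') \/
   ((forall d' : M, ~ target_bound b d') /\ is_empty d)).

Section MenasDefinable.
Context {I : Type} {Ms : I -> structure}.
Implicit Types t u : forall i : I, (nat -> Ms i) -> Ms i.

Lemma definable_target_bound t u :
  is_symbol t -> is_symbol u -> definable (fun i e => target_bound (t i e) (u i e)).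
Proof. intros; unfold target_bound, target; definability. Qed.
#[local] Hint Resolve definable_target_bound : definability.

Lemma definable_menas t u :
  is_symbol t -> is_symbol u -> definable (fun i e => menas (t i e) (u i e)).
Proof. intros; unfold menas; definability. Qed.

End MenasDefinable.

#[export] Hint Resolve definable_target_bound definable_menas : definability.

Lemma menas_uniformly_definable : uniformly_definable (fun N e => menas (e 0) (e 1)).
Proof. definability. Qed.

Definition menas_formula : formula :=
  witness (uniformly_definable_formula _ menas_uniformly_definable).

Lemma holds_menas_formula {M : structure} (e : nat -> M) :
  holds menas_formula e <-> menas (e 0) (e 1).
Proof. exact (witness_spec (uniformly_definable_formula _ menas_uniformly_definable) M e). Qed.

Section MenasFunction.
Context {M : structure} {HM : Zermelo M}.
Implicit Types b d : M.

Lemma menas_ordinal b d : menas b d -> ordinal b /\ ordinal d.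
Proof.
  intros (Hb & [[[Hd _] _]|[_ Hd]]); (split; [exact Hb|]); [exact Hd|].
  apply is_empty_iff in Hd; subst. exact ordinal_empty_set.
Qed.

Lemma menas_functional b d d' : menas b d -> menas b d' -> d = d'.
Proof.
  intros (_ & [[Hd d_least]|[Hnone Hd]]) (_ & [[Hd' d'_least]|[Hnone' Hd']]).
  - destruct (ordinal_trichotomy d d') as [Hlt|[Heq|Hlt]];
      [apply Hd|apply Hd'| |exact Heq|].
    + destruct (d'_least d Hlt Hd).
    + destruct (d_least d' Hlt Hd').
  - destruct (Hnone' d Hd).
  - destruct (Hnone d' Hd').
  - apply is_empty_iff in Hd, Hd'. congruence.
Qed.

Lemma menas_total b : ordinal b -> exists d, menas b d.
Proof.
  intros Hb. destruct (classic (exists d, target_bound b d)) as [[d Hd]|Hnone].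
  - destruct (ordinal_least (target_bound b) d) as (m & _ & Hm & m_least);
      [definability|exact (proj1 Hd)|exact Hd|].
    exists m. split; [exact Hb|left; auto].
  - exists empty_set. split; [exact Hb|right]. split; [|exact mem_empty_set].
    intros d Hd. apply Hnone; exists d; exact Hd.
Qed.

Lemma menas_ord_class_function : ord_class_function (M := M) menas.
Proof.
  split; [exact menas_ordinal|]. intros b Hb.
  destruct (menas_total b Hb) as [d Hd]. exists d.
  split; [exact Hd|]. intros d'. exact (menas_functional b d d' Hd).
Qed.

End MenasFunction.

Section MenasInStage.
Context {M : structure} {HM : Zermelo M} {HR : Ranked M} {l U : M}.
Context (l_limit : limit_ordinal l) (omega_lt_l : omega ∈ l) (HU : is_V l U).

Lemma target_absolute (b g : substructure U) : target b g <-> target (val b) (val g).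
Proof.
  unfold target. rewrite (inaccessible_absolute l_limit omega_lt_l HU).
  split; intros (Hg & Vb & Vg & HVb & HVg & Hel); (split; [exact Hg|]).
  - exists (val Vb), (val Vg).
    rewrite <- !(is_V_absolute l_limit omega_lt_l HU),
      <- (elementary_absolute l_limit omega_lt_l HU). auto.
  - assert (Hb : ordinal b) by apply (ordinal_absolute HU), HVb.
    assert (Hg' : ordinal g) by apply (ordinal_absolute HU), HVg.
    destruct (is_V_val_exists HU b Hb) as [Wb HWb], (is_V_val_exists HU g Hg') as [Wg HWg].
    rewrite (is_V_unique _ _ _ HVb HWb), (is_V_unique _ _ _ HVg HWg) in Hel.
    exists Wb, Wg.
    rewrite !(is_V_absolute l_limit omega_lt_l HU), (elementary_absolute l_limit omega_lt_l HU).
    auto.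
Qed.

Lemma target_bound_of_val (b d : substructure U) :
  target_bound (val b) (val d) -> target_bound b d.
Proof.
  intros [Hd d_bound]. split; [apply (ordinal_absolute HU), Hd|].
  intros g Hg. apply (d_bound (val g)), target_absolute, Hg.
Qed.

Lemma stage_menas_exists :
  exists f, partial_function f l l /\
    forall x y : substructure U, rel f (val x) (val y) <-> menas x y.
Proof.
  assert (HN := substructure_Zermelo l_limit omega_lt_l HU).
  destruct (partial_function_exists (fun a b => exists x y : substructure U,
    a = val x /\ b = val y /\ menas x y) l l) as (f & f_partial & Hf).
  - apply definable_relation_substructure. definability.
  - intros a b b' _ (x & y & -> & -> & Hxy) (x' & y' & Heq & -> & Hxy').
    apply val_inj in Heq; subst. f_equal. exact (menas_functional x' y y' Hxy Hxy').
  - exists f. split; [exact f_partial|]. intros x y. rewrite Hf. split.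
    + intros (_ & _ & x' & y' & Hx & Hy & Hxy). apply val_inj in Hx, Hy; subst. exact Hxy.
    + intros Hxy. assert (Hord := menas_ordinal x y Hxy).
      rewrite !(ordinal_absolute HU) in Hord.
      split; [exact (proj1 (ordinal_mem_V l U _ HU (proj1 Hord)) (val_mem x))|].
      split; [exact (proj1 (ordinal_mem_V l U _ HU (proj2 Hord)) (val_mem y))|eauto].
Qed.

(* The targets of [x] in [V_l] are those up to [g]. *)
Lemma menas_below_next_target (x y : substructure U) (g : M) :
  target (val x) g -> val y = successor g ->
  (forall g', target (val x) g' -> g' ∈ l -> ~ g ∈ g') -> menas x y.
Proof.
  intros Hg Hy g_last.
  assert (Hg_ord := inaccessible_ordinal g (proj1 Hg)).
  assert (Hx : ordinal x).
  { destruct Hg as (_ & Vx & _ & HVx & _). apply (ordinal_absolute HU), HVx. }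
  split; [exact Hx|left]. split; [split|].
  - apply (ordinal_absolute HU). rewrite Hy. exact (ordinal_successor g Hg_ord).
  - intros z Hz%target_absolute.
    assert (Hz_ord := inaccessible_ordinal _ (proj1 Hz)).
    assert (Hzl := proj1 (ordinal_mem_V l U _ HU Hz_ord) (val_mem z)).
    change (val z ∈ val y). rewrite Hy, mem_successor.
    destruct (ordinal_trichotomy (val z) g Hz_ord Hg_ord) as [Hlt|[Heq|Hgt]]; auto.
    destruct (g_last (val z) Hz Hzl Hgt).
  - intros z Hz [_ z_bound]. change (val z ∈ val y) in Hz. rewrite Hy, mem_successor in Hz.
    destruct (val_mem_surj HU y g) as [g' Hg'].
    { rewrite Hy. apply mem_successor_self. }
    assert (Hgz : g ∈ val z).
    { rewrite <- Hg'. apply (z_bound g'), target_absolute. rewrite Hg'. exact Hg. }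
    destruct Hz as [Hz|Hz]; [exact (mem_asym _ _ Hgz Hz)|].
    rewrite Hz in Hgz. exact (mem_irrefl g Hgz).
Qed.

End MenasInStage.

(** ** Uplifting cardinals *)

Section Uplifting.
Context {M : structure} {HM : Zermelo M} {HR : Ranked M}.
Implicit Types a b c d f g th : M.

Lemma uplifting_unbounded k Vk th :
  uplifting k -> is_V k Vk -> ordinal th ->
  exists g Vg, inaccessible g /\ th ∈ g /\ is_V g Vg /\ elementary Vk None Vg None.
Proof.
  intros [_ k_uplifting] HVk Hth.
  destruct (k_uplifting (successor th) (ordinal_successor th Hth))
    as (g & Vk' & Vg & Hg & Hle & HVk' & HVg & Hel & _).
  rewrite (is_V_unique k Vk' Vk HVk' HVk) in Hel.
  exists g, Vg. split; [exact Hg|split; [|auto]].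
  destruct Hle as [Hlt|Heq]; [|rewrite <- Heq; apply mem_successor_self].
  exact (ordinal_trans g _ th (inaccessible_ordinal g Hg) Hlt (mem_successor_self th)).
Qed.

Lemma next_target_exists b g g' :
  target b g' -> g ∈ g' ->
  exists g1, target b g1 /\ g ∈ g1 /\ forall c, target b c -> c ∈ g1 -> ~ g ∈ c.
Proof.
  intros Hg' Hlt.
  destruct (ordinal_least (fun c => target b c /\ g ∈ c) g') as (g1 & _ & [Hg1 Hgg1] & g1_least).
  - unfold target. definability.
  - exact (inaccessible_ordinal g' (proj1 Hg')).
  - auto.
  - exists g1. split; [exact Hg1|split; [exact Hgg1|]].
    intros c Hc Hcg1 Hgc. exact (g1_least c Hcg1 (conj Hc Hgc)).
Qed.

Section UpliftingCardinal.
Context {k Vk : M} (Hk : uplifting k) (HVk : is_V k Vk).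

Lemma target_bound_absolute (x y : substructure Vk) :
  target_bound x y <-> target_bound (val x) (val y).
Proof.
  assert (k_limit := inaccessible_limit k (proj1 Hk)).
  assert (k_omega := inaccessible_omega k (proj1 Hk)).
  split; [|exact (target_bound_of_val k_limit k_omega HVk x y)].
  intros Hy. split; [apply (ordinal_absolute HVk), Hy|]. intros c Hc.
  destruct (uplifting_unbounded k Vk c Hk HVk (inaccessible_ordinal c (proj1 Hc)))
    as (g & Vg & Hg & Hcg & HVg & Hel).
  assert (Hsub := proj1 (proj2 Hel)).
  destruct (val_surj (val x) (Hsub _ (val_mem x))) as [x' Hx'].
  destruct (val_surj (val y) (Hsub _ (val_mem y))) as [y' Hy'].
  destruct (val_surj c (ordinal_subset_V g Vg HVg c Hcg)) as [c' <-].
  assert (y'_bound : target_bound x' y').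
  { apply (elementary_uniformly_definable Vk Vg (fun N e => target_bound (e 0) (e 1))
      (scons x (fun _ => y)) (scons x' (fun _ => y'))); [definability|exact Hel| |exact Hy].
    intros [|n]; symmetry; assumption. }
  rewrite <- Hy'. apply (proj2 y'_bound c').
  apply (target_absolute (inaccessible_limit g Hg) (inaccessible_omega g Hg) HVg).
  rewrite Hx'. exact Hc.
Qed.

Lemma target_bound_reflects (x : substructure Vk) d :
  target_bound (val x) d -> exists y : substructure Vk, target_bound x y.
Proof.
  intros Hd.
  destruct (uplifting_unbounded k Vk d Hk HVk (proj1 Hd)) as (g & Vg & Hg & Hdg & HVg & Hel).
  destruct (val_surj (val x) (proj1 (proj2 Hel) _ (val_mem x))) as [x' Hx'].
  destruct (val_surj d (ordinal_subset_V g Vg HVg d Hdg)) as [d' <-].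
  apply (elementary_uniformly_definable Vk Vg (fun N e => exists y : N, target_bound (e 0) y)
    (fun _ => x) (fun _ => x')); [definability|exact Hel|auto|].
  exists d'.
  apply (target_bound_of_val (inaccessible_limit g Hg) (inaccessible_omega g Hg) HVg).
  rewrite Hx'. exact Hd.
Qed.

Lemma menas_absolute (x y : substructure Vk) : menas x y <-> menas (val x) (val y).
Proof.
  assert (least_absolute : (forall z, z ∈ y -> ~ target_bound x z) <->
    (forall z, z ∈ val y -> ~ target_bound (val x) z)).
  { split; intros y_least z Hz.
    - destruct (val_mem_surj HVk y z Hz) as [z' <-].
      rewrite <- target_bound_absolute. exact (y_least z' Hz).
    - rewrite target_bound_absolute. exact (y_least _ Hz). }
  assert (unbounded_absolute : (forall z, ~ target_bound x z) <->
    (forall z, ~ target_bound (val x) z)).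
  { split; intros Hnone z Hz.
    - destruct (target_bound_reflects x z Hz) as [z' Hz']. exact (Hnone z' Hz').
    - apply (Hnone (val z)), target_bound_absolute, Hz. }
  assert (k_limit := inaccessible_limit k (proj1 Hk)).
  assert (k_omega := inaccessible_omega k (proj1 Hk)).
  unfold menas. rewrite (ordinal_absolute HVk), target_bound_absolute, least_absolute,
    unbounded_absolute, (is_empty_absolute k_limit k_omega HVk).
  reflexivity.
Qed.

Lemma menas_maps_into b d : b ∈ k -> menas b d -> d ∈ k.
Proof.
  intros Hb Hd. apply (ordinal_mem_V k Vk d HVk (proj2 (menas_ordinal b d Hd))).
  destruct Hd as (_ & [[Hd d_least]|[_ Hd]]).
  - destruct (val_surj b (ordinal_subset_V k Vk HVk b Hb)) as [x <-].
    destruct (target_bound_reflects x d Hd) as [y Hy%target_bound_absolute].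
    apply (V_subset_closed k Vk (val y) d HVk (val_mem y)).
    apply ordinal_not_mem; [apply Hy|apply Hd|].
    intros Hlt. exact (d_least _ Hlt Hy).
  - apply is_empty_iff in Hd; subst.
    apply (V_transitive k Vk HVk omega); [|exact empty_set_mem_omega].
    exact (ordinal_subset_V k Vk HVk omega (inaccessible_omega k (proj1 Hk))).
Qed.

Lemma menas_restriction_exists :
  exists f, total_function f k k /\ forall a b, rel f a b <-> a ∈ k /\ menas a b.
Proof.
  apply total_function_exists.
  - definability.
  - intros a Ha. apply menas_ord_class_function.
    exact (ordinal_mem k a (inaccessible_ordinal k (proj1 Hk)) Ha).
  - exact menas_maps_into.
Qed.

Lemma menas_formula_defines_restriction f :
  (forall a b, rel f a b <-> a ∈ k /\ menas a b) -> defines_in menas_formula Vk f.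
Proof.
  intros Hf e. rewrite holds_menas_formula, Hf, menas_absolute. split; [|tauto].
  intros Hmenas. split; [|exact Hmenas].
  apply (ordinal_mem_V k Vk _ HVk); [apply (menas_ordinal _ _ Hmenas)|apply val_mem].
Qed.

(* If [g0 > th] is a target of [k] and [g] is the least target of [k] above [g0], then
   [V_g] computes the value [g0 + 1] at [k]. *)
Lemma menas_exceeds_in_target th :
  ordinal th ->
  exists g Vg d, inaccessible g /\ th ∈ g /\ is_V g Vg /\ elementary Vk None Vg None /\
    th ∈ d /\ exists x y : substructure Vg, val x = k /\ val y = d /\ menas x y.
Proof.
  intros Hth. assert (Hk_ord := inaccessible_ordinal k (proj1 Hk)).
  destruct (ordinal_max th k Hth Hk_ord) as (m & m_eq & Hthm & Hkm).
  assert (Hm : ordinal m) by (destruct m_eq; subst; assumption).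
  destruct (uplifting_unbounded k Vk m Hk HVk Hm) as (g0 & V0 & Hg0 & Hmg0 & HV0 & Hel0).
  assert (Hg0_ord := inaccessible_ordinal g0 Hg0).
  destruct (uplifting_unbounded k Vk g0 Hk HVk Hg0_ord)
    as (g' & V' & Hg' & Hg0g' & HV' & Hel').
  destruct (next_target_exists k g0 g')
    as (g & (Hg & Vk' & Vg & HVk' & HVg & Hel) & Hg0g & g_least);
    [split; [exact Hg'|eauto]|exact Hg0g'|].
  rewrite (is_V_unique k Vk' Vk HVk' HVk) in Hel.
  assert (Hg_ord := inaccessible_ordinal g Hg).
  assert (Hthg0 := ordinal_le_trans th m g0 Hg0_ord Hthm Hmg0).
  assert (Hkg0 := ordinal_le_trans k m g0 Hg0_ord Hkm Hmg0).
  assert (g_limit := inaccessible_limit g Hg). assert (g_omega := inaccessible_omega g Hg).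
  destruct (val_surj k (ordinal_subset_V g Vg HVg k (ordinal_trans g g0 k Hg_ord Hg0g Hkg0)))
    as [x Hx].
  destruct (val_surj (successor g0)
    (ordinal_subset_V g Vg HVg _ (proj2 g_limit g0 Hg0g))) as [y Hy].
  exists g, Vg, (successor g0).
  split; [exact Hg|split; [exact (ordinal_trans g g0 th Hg_ord Hg0g Hthg0)|]].
  split; [exact HVg|split; [exact Hel|split; [apply mem_successor; auto|]]].
  exists x, y. split; [exact Hx|split; [exact Hy|]].
  apply (menas_below_next_target g_limit g_omega HVg x y g0); rewrite ?Hx; auto.
  split; [exact Hg0|eauto].
Qed.

Lemma menas_restriction_uplifting_Menas f :
  total_function f k k -> (forall a b, rel f a b <-> a ∈ k /\ menas a b) ->
  uplifting_Menas k f.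
Proof.
  intros f_total Hf. split; [apply f_total|]. intros th Hth.
  destruct (menas_exceeds_in_target th Hth)
    as (g & Vg & d & Hg & Hthg & HVg & Hel & Hthd & x & y & Hx & Hy & Hxy).
  destruct (stage_menas_exists (inaccessible_limit g Hg) (inaccessible_omega g Hg) HVg)
    as (fs & fs_partial & Hfs).
  exists g, fs, Vk, Vg. do 5 (split; [assumption|]). split.
  - apply (elementary_definable_expansion menas_formula); [exact Hel| |].
    + exact (menas_formula_defines_restriction f Hf).
    + intros e. rewrite holds_menas_formula, Hfs. reflexivity.
  - exists d. split; [rewrite <- Hx, <- Hy; apply Hfs, Hxy|left; exact Hthd].
Qed.

End UpliftingCardinal.

Lemma uplifting_menas_restriction k :
  uplifting k ->
  exists f Vk, is_restriction menas k f /\ total_function f k k /\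
    is_V k Vk /\ definable_in Vk f /\ uplifting_Menas k f.
Proof.
  intros Hk. destruct (V_exists k (inaccessible_ordinal k (proj1 Hk))) as [Vk HVk].
  destruct (menas_restriction_exists Hk HVk) as (f & f_total & Hf).
  exists f, Vk. split; [exact (rel_iff_is_restriction menas k f k (proj1 f_total) Hf)|].
  split; [exact f_total|split; [exact HVk|split]].
  - apply (defines_in_definable_in menas_formula).
    exact (menas_formula_defines_restriction Hk HVk f Hf).
  - exact (menas_restriction_uplifting_Menas Hk HVk f f_total Hf).
Qed.

End Uplifting.

Theorem theorem4p4 :
  exists phi : formula, forall M : structure, ZFC M ->
    (exists F : M -> M -> Prop,
       defines phi F /\ ord_class_function F /\
       forall k : M, uplifting k ->
         exists f Vk : M,
           is_restriction F k f /\ total_function f k k /\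
           is_V k Vk /\ definable_in Vk f /\ uplifting_Menas k f) /\
    (forall k : M, uplifting k ->
       exists f : M, total_function f k k /\ uplifting_Menas k f).
Proof.
  exists menas_formula. intros M HZFC.
  assert (HM := ZFC_Zermelo HZFC). assert (HR := ZFC_Ranked HZFC). split.
  - exists menas. split; [exact holds_menas_formula|].
    split; [exact menas_ord_class_function|exact uplifting_menas_restriction].
  - intros k Hk.
    destruct (uplifting_menas_restriction k Hk) as (f & Vk & _ & f_total & _ & _ & f_Menas).
    exists f. split; assumption.
Qed.
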